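(* Every direct decomposition $M_3(\mathbb{C}) = S\oplus M$ into two subalgebras with $\dim S = 4$ and $\dim M = 5$, neither of which contains the identity matrix, is, up to transpose and up to the action of $\mathrm{Aut}(M_3(\mathbb{C}))$, one of the following decompositions (the first summand is $S$, the second is $M$): (B1) $\mathrm{Span}\{e_{21},e_{31},e_{32},e_{33}\}\oplus \mathrm{Span}\{e_{11},e_{12},e_{13},e_{22},e_{23}\}$, (B2) $\mathrm{Span}\{e_{11}+e_{21},e_{31},e_{32},e_{33}\}\oplus \mathrm{Span}\{e_{11},e_{12},e_{13},e_{22},e_{23}\}$, (B3) $\mathrm{Span}\{e_{21},e_{31},e_{32},e_{22}+e_{33}\}\oplus \mathrm{Span}\{e_{11},e_{12},e_{13},e_{22},e_{23}\}$, (B4) $\mathrm{Span}\{e_{21},e_{31},e_{32}+e_{23},e_{22}+e_{33}\}\oplus \mathrm{Span}\{e_{11},e_{12},e_{13},e_{22},e_{23}\}$, (B5) $\mathrm{Span}\{e_{21},e_{31},e_{32},e_{11}+e_{33}\}\oplus \mathrm{Span}\{e_{11},e_{12},e_{13},e_{22},e_{23}\}$, (B6) $\mathrm{Span}\{e_{21},e_{31},e_{32},e_{22}\}\oplus \mathrm{Span}\{e_{11},e_{12},e_{13},e_{23},e_{33}\}$, (B7) $\mathrm{Span}\{e_{21},e_{11}+e_{31},e_{12}+e_{32},e_{22}\}\oplus \mathrm{Span}\{e_{11},e_{12},e_{13},e_{23},e_{33}\}$, (B8) $\mathrm{Span}\{e_{21},e_{31},e_{32},e_{22}+e_{33}\}\oplus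 \mathrm{Span}\{e_{11},e_{12},e_{13},e_{23},e_{33}\}$, (B9) $\mathrm{Span}\{e_{21},e_{31},e_{32}+e_{23},e_{22}+e_{33}\}\oplus \mathrm{Span}\{e_{11},e_{12},e_{13},e_{23},e_{33}\}$. Moreover, the decompositions (B1)--(B9) lie in pairwise different orbits under the action of automorphisms and antiautomorphisms of $M_3(\mathbb{C})$.
   Context: $M_3(\mathbb{C})$ is the associative $\mathbb{C}$-algebra of $3\times 3$ complex matrices, and $e_{ij}$ denotes the matrix unit with $1$ in position $(i,j)$ and $0$ elsewhere. A subalgebra is a $\mathbb{C}$-linear subspace closed under multiplication (it is not required to contain the identity matrix, nor to be an ideal). $\mathrm{Span}$ denotes the $\mathbb{C}$-linear span. A direct decomposition $M_3(\mathbb{C}) = S\oplus M$ means that $S$ and $M$ are subalgebras, $S+M=M_3(\mathbb{C})$ and $S\cap M=(0)$, i.e. the sum is a direct sum of vector spaces. $\mathrm{Aut}(M_3(\mathbb{C}))$ is the group of $\mathbb{C}$-algebra automorphisms; antiautomorphisms are bijective $\mathbb{C}$-linear maps reversing products. These maps act on decompositions by $\varphi\cdot(S\oplus M)=\varphi(S)\oplus\varphi(M)$. ''Up to transpose and up to the action of $\mathrm{Aut}(M_3(\mathbb{C}))$'' means: there is an automorphism $\varphi$ such that either $\varphi$, or the composition of $\varphi$ with the transpose map $X\mapsto X^T$, carries $S$ and $M$ simultaneously onto the corresponding summands of a decomposition in the list. *)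

(* Defs.v *)
From mathcomp Require Import all_boot all_order all_algebra.

Set Implicit Arguments.
Unset Strict Implicit.
Unset Printing Implicit Defensive.

Import GRing.Theory.
Local Open Scope ring_scope.

Section Decompositions.
Variable F : fieldType.

(* Subalgebras are not required to contain 1, so falgebra's {aspace _}, whose
   members have a unit element of their own, does not apply. *)
Definition subalgebra (U : {vspace 'M[F]_3}) : Prop :=
  forall X Y : 'M[F]_3, X \in U -> Y \in U -> X *m Y \in U.

Definition direct_decomposition (D : {vspace 'M[F]_3} * {vspace 'M[F]_3}) :
    Prop :=
  [/\ subalgebra D.1, subalgebra D.2,
      (D.1 + D.2)%VS = fullv & (D.1 :&: D.2)%VS = 0%VS].

Definition nonunital_4_5 (D : {vspace 'M[F]_3} * {vspace 'M[F]_3}) : Prop :=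
  [/\ \dim D.1 = 4%N, \dim D.2 = 5%N, 1%:M \notin D.1 & 1%:M \notin D.2].

Definition automorphism (f : 'End('M[F]_3)) : Prop :=
  [/\ bijective f, f 1%:M = 1%:M
    & forall X Y : 'M[F]_3, f (X *m Y) = f X *m f Y].

Definition antiautomorphism (f : 'End('M[F]_3)) : Prop :=
  bijective f /\ forall X Y : 'M[F]_3, f (X *m Y) = f Y *m f X.

Definition transpose : 'End('M[F]_3) := linfun (@trmx F 3 3).

Definition act (f : 'End('M[F]_3)) (D : {vspace 'M[F]_3} * {vspace 'M[F]_3}) :
    {vspace 'M[F]_3} * {vspace 'M[F]_3} :=
  ((f @: D.1)%VS, (f @: D.2)%VS).

(* Matrix units with indices counted from 1: i and j range over 1, 2, 3. *)
Definition e (i j : nat) : 'M[F]_3 := delta_mx (inord i.-1) (inord j.-1).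

Definition spans (X Y : seq 'M[F]_3) :
    {vspace 'M[F]_3} * {vspace 'M[F]_3} := (<<X>>%VS, <<Y>>%VS).

Definition decompositionsB : 9.-tuple ({vspace 'M[F]_3} * {vspace 'M[F]_3}) :=
  let M1 := [:: e 1 1; e 1 2; e 1 3; e 2 2; e 2 3] in
  let M2 := [:: e 1 1; e 1 2; e 1 3; e 2 3; e 3 3] in
  [tuple
     spans [:: e 2 1; e 3 1; e 3 2; e 3 3] M1;
     spans [:: e 1 1 + e 2 1; e 3 1; e 3 2; e 3 3] M1;
     spans [:: e 2 1; e 3 1; e 3 2; e 2 2 + e 3 3] M1;
     spans [:: e 2 1; e 3 1; e 3 2 + e 2 3; e 2 2 + e 3 3] M1;
     spans [:: e 2 1; e 3 1; e 3 2; e 1 1 + e 3 3] M1;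
     spans [:: e 2 1; e 3 1; e 3 2; e 2 2] M2;
     spans [:: e 2 1; e 1 1 + e 3 1; e 1 2 + e 3 2; e 2 2] M2;
     spans [:: e 2 1; e 3 1; e 3 2; e 2 2 + e 3 3] M2;
     spans [:: e 2 1; e 3 1; e 3 2 + e 2 3; e 2 2 + e 3 3] M2].

End Decompositions.

(* Main.v *)
Require Import Defs.
From mathcomp Require Import all_boot all_order all_algebra.
From mathcomp Require Import reals complex.
From mathcomp Require Import ring.

(** Let M_3 = S + M be a direct decomposition with dim S = 4, dim M = 5 and
    the identity in neither summand.

    The shape of M.  Since 1 is not in M, the Cayley-Hamilton identity makes
    every element of M singular.  If moreover the second elementary symmetric
    function of the eigenvalues vanished on M, the trace would be
    multiplicative on M, so its kernel on M, of dimension at least 4, would be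
    orthogonal for the trace form to the 6-dimensional space M + <1>, which is
    impossible in dimension 9 ([unit_of_trace_multiplicative]).  So M contains
    an X with X^3 = a X^2 - b X and b <> 0, and then a polynomial in X is an
    idempotent of rank 2, conjugate to e11 + e22.  Peirce decomposition shows
    that M then lies in a 6-dimensional space containing the units e11, e12 and
    e21; as M has codimension at most 1 there, a further conjugation puts
    e11 and e22 in M ([exists_conj_diagonal_units]).  From then on M is spanned
    by five matrix units, which form a linear order on the three indices minus
    one diagonal unit ([linear_order_units]); a permutation of the basis,
    followed if needed by the transpose, turns M into the upper triangular
    matrices with vanishing entry (3,3) (the space M1), or with vanishing entry
    (2,2) (the space M2).

    The shape of S.  Let chi be the diagonal entry that vanishes on M, a
    character of the upper triangular algebra T.  Writing 1 = t + m with t in S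
    and m in M gives t in T with chi(t) = 1, and t is an idempotent because
    t^2 - t lies in both S and M.  A unipotent upper triangular matrix
    conjugates t to its diagonal part and preserves M.  So S contains a
    diagonal idempotent t with chi(t) = 1 other than 1, and there are three
    choices for each of M1 and M2.  As S complements M, it contains a lift of
    each strictly lower triangular matrix; multiplying lifts on both sides by t
    and 1 - t leaves very few unknown entries, and these are normalised by one
    more triangular conjugation.  Whether some scalar is zero then separates
    the first decomposition of the list from the second, the third from the
    fourth, the sixth from the seventh and the eighth from the ninth.  Square
    roots serve to normalise the fourth and the ninth.

    Distinct orbits.  Four properties invariant under automorphisms and
    antiautomorphisms take different values on the nine decompositions:
    existence of a nonzero matrix annihilating M on one side, the identities
    tr(X^2) = (tr X)^2 and 2 tr(X^2) = (tr X)^2 on S, and the vanishing of all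
    [X,Y] Z or of all Z [X,Y] on S ([invariant_tableP]). *)

Set Implicit Arguments.
Unset Strict Implicit.
Unset Printing Implicit Defensive.

Import GRing.Theory.
Local Open Scope ring_scope.

(** * Explicit 3 x 3 matrices *)

Section Coordinates.
Context (F : fieldType).
Implicit Types (X Y : 'M[F]_3) (L : seq 'M[F]_3).

Definition mx3 (a b c d e f g h k : F) : 'M[F]_3 :=
  \matrix_(i, j)
    nth 0 (nth [::] [:: [:: a; b; c]; [:: d; e; f]; [:: g; h; k]] i) j.

(** Case analysis on [mx3P X] replaces a matrix by its nine entries, after
    which matrix equations reduce to nine scalar identities. *)
Variant mx3_spec : 'M[F]_3 -> Type :=
  Mx3Spec a b c d e f g h k : mx3_spec (mx3 a b c d e f g h k).

Lemma mx3P X : mx3_spec X.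
Proof.
pose i2 : 'I_3 := inord 2.
suff -> : X = mx3 (X 0 0) (X 0 1) (X 0 i2) (X 1 0) (X 1 1) (X 1 i2)
                  (X i2 0) (X i2 1) (X i2 i2) by constructor.
apply/matrixP => i j; rewrite !mxE.
case: i j => [[|[|[|i]]] Hi] [[|[|[|j]]] Hj] //=;
  by congr (X _ _); apply/val_inj; rewrite /= ?inordK.
Qed.

Lemma mx3_inj a b c d e f g h k a' b' c' d' e' f' g' h' k' :
  mx3 a b c d e f g h k = mx3 a' b' c' d' e' f' g' h' k' ->
  [:: a; b; c; d; e; f; g; h; k] = [:: a'; b'; c'; d'; e'; f'; g'; h'; k'].
Proof.
move=> /matrixP eqX; pose i2 : 'I_3 := inord 2.
have [vi2 v0 v1] : [/\ i2 = 2%N :> nat, (0 : 'I_3) = 0%N :> nat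
                     & (1 : 'I_3) = 1%N :> nat] by rewrite /= inordK.
move: (eqX 0 0) (eqX 0 1) (eqX 0 i2) (eqX 1 0) (eqX 1 1) (eqX 1 i2)
      (eqX i2 0) (eqX i2 1) (eqX i2 i2).
by rewrite !mxE vi2 /= => -> -> -> -> -> -> -> -> ->.
Qed.

Lemma mx3_mul a b c d e f g h k a' b' c' d' e' f' g' h' k' :
  mx3 a b c d e f g h k *m mx3 a' b' c' d' e' f' g' h' k' =
  mx3 (a*a'+b*d'+c*g') (a*b'+b*e'+c*h') (a*c'+b*f'+c*k')
      (d*a'+e*d'+f*g') (d*b'+e*e'+f*h') (d*c'+e*f'+f*k')
      (g*a'+h*d'+k*g') (g*b'+h*e'+k*h') (g*c'+h*f'+k*k').
Proof.
apply/matrixP => i j; rewrite !mxE !big_ord_recl big_ord0 !mxE.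
by case: i j => [[|[|[|i]]] Hi] [[|[|[|j]]] Hj] //=; rewrite addr0 !addrA.
Qed.

Lemma mx3_add a b c d e f g h k a' b' c' d' e' f' g' h' k' :
  mx3 a b c d e f g h k + mx3 a' b' c' d' e' f' g' h' k' =
  mx3 (a+a') (b+b') (c+c') (d+d') (e+e') (f+f') (g+g') (h+h') (k+k').
Proof.
apply/matrixP => i j; rewrite !mxE.
by case: i j => [[|[|[|i]]] Hi] [[|[|[|j]]] Hj].
Qed.

Lemma mx3_opp a b c d e f g h k :
  - mx3 a b c d e f g h k =
  mx3 (-a) (-b) (-c) (-d) (-e) (-f) (-g) (-h) (-k).
Proof.
apply/matrixP => i j; rewrite !mxE.
by case: i j => [[|[|[|i]]] Hi] [[|[|[|j]]] Hj].
Qed.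

Lemma mx3_scale x a b c d e f g h k :
  x *: mx3 a b c d e f g h k =
  mx3 (x*a) (x*b) (x*c) (x*d) (x*e) (x*f) (x*g) (x*h) (x*k).
Proof.
apply/matrixP => i j; rewrite !mxE.
by case: i j => [[|[|[|i]]] Hi] [[|[|[|j]]] Hj].
Qed.

Lemma mx3_tr a b c d e f g h k :
  (mx3 a b c d e f g h k)^T = mx3 a d g b e h c f k.
Proof.
apply/matrixP => i j; rewrite !mxE.
by case: i j => [[|[|[|i]]] Hi] [[|[|[|j]]] Hj].
Qed.

Lemma mx3_trace a b c d e f g h k : \tr (mx3 a b c d e f g h k) = a + e + k.
Proof. by rewrite /mxtrace !big_ord_recl big_ord0 !mxE /= addr0 addrA. Qed.

Lemma mx3_0 : 0 = mx3 0 0 0 0 0 0 0 0 0.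
Proof.
apply/matrixP => i j; rewrite !mxE.
by case: i j => [[|[|[|i]]] Hi] [[|[|[|j]]] Hj].
Qed.

Lemma mx3_1 : 1%:M = mx3 1 0 0 0 1 0 0 0 1.
Proof.
apply/matrixP => i j; rewrite !mxE.
by case: i j => [[|[|[|i]]] Hi] [[|[|[|j]]] Hj].
Qed.

Lemma mx3_e :
  (e F 1 1 = mx3 1 0 0 0 0 0 0 0 0) * (e F 1 2 = mx3 0 1 0 0 0 0 0 0 0) *
  (e F 1 3 = mx3 0 0 1 0 0 0 0 0 0) * (e F 2 1 = mx3 0 0 0 1 0 0 0 0 0) *
  (e F 2 2 = mx3 0 0 0 0 1 0 0 0 0) * (e F 2 3 = mx3 0 0 0 0 0 1 0 0 0) *
  (e F 3 1 = mx3 0 0 0 0 0 0 1 0 0) * (e F 3 2 = mx3 0 0 0 0 0 0 0 1 0) *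
  (e F 3 3 = mx3 0 0 0 0 0 0 0 0 1).
Proof.
do !split; apply/matrixP => i j; rewrite !mxE -!val_eqE /= !inordK //;
by case: i j => [[|[|[|i]]] Hi] [[|[|[|j]]] Hj].
Qed.

(** Without the matrix units: rewriting those would also change the spanning
    families in the membership goals. *)
Definition mx3_opE :=
  (mx3_mul, mx3_add, mx3_opp, mx3_scale, mx3_tr, mx3_0, mx3_1).

Definition mx3E :=
  (mx3_mul, mx3_add, mx3_opp, mx3_scale, mx3_tr, mx3_0, mx3_1, mx3_e).

Lemma mem_spanP L X :
  X \in <<L>>%VS <->
  exists c : seq F, X = \sum_(i < size L) c`_i *: L`_i.
Proof.
split=> [LX | [c ->]].
  exists (mkseq (fun i => if insub i is Some i then coord (in_tuple L) i X else 0)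
                (size L)).
  rewrite [LHS](coord_span (X := in_tuple L) LX).
  by apply: eq_bigr => i _; rewrite nth_mkseq // valK.
by apply: memv_suml => i _; rewrite memvZ // memv_span // mem_nth.
Qed.

End Coordinates.

(** * Linear equations of the spaces S_i and M_j *)

(** A span given by explicit generators equals the space cut out by linear
    equations: [cs] lists the coordinates of a solution in these generators. *)
Ltac mem_span_coefs cs :=
  apply/idP/idP;
  [ move=> /mem_spanP [? ];
    rewrite /= !big_ord_recl big_ord0 /= !mx3E;
    move=> /mx3_inj [] *; subst;
    rewrite ?eqxx /=; do ?[apply/andP; split]; apply/eqP; ring
  | do ?[case/andP=> /eqP->]; move=> /eqP->;
    apply/mem_spanP; exists cs;
    rewrite /= !big_ord_recl big_ord0 /= !mx3E; congr mx3; ring ].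

Section Membership.
Context (F : fieldType).
Local Notation e := (e F).

(** The upper triangular matrices whose entry (3,3), respectively (2,2) for
    [M2], is zero: the kernels of two characters of the triangular algebra. *)
Definition M1 : {vspace 'M[F]_3} :=
  <<[:: e 1 1; e 1 2; e 1 3; e 2 2; e 2 3]>>%VS.
Definition M2 : {vspace 'M[F]_3} :=
  <<[:: e 1 1; e 1 2; e 1 3; e 2 3; e 3 3]>>%VS.

Context (a b c d l f g h k : F).
Local Notation X := (mx3 a b c d l f g h k).

Lemma mem_M1 : (X \in M1)
    = [&& d == 0, g == 0, h == 0 & k == 0].
Proof. mem_span_coefs [:: a; b; c; l; f]. Qed.
Lemma mem_M2 : (X \in M2)
    = [&& d == 0, l == 0, g == 0 & h == 0].
Proof. mem_span_coefs [:: a; b; c; f; k]. Qed.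
Lemma mem_S1 : (X \in <<[:: e 2 1; e 3 1; e 3 2; e 3 3]>>%VS)
    = [&& a == 0, b == 0, c == 0, l == 0 & f == 0].
Proof. mem_span_coefs [:: d; g; h; k]. Qed.
Lemma mem_S2 : (X \in <<[:: (e 1 1 + e 2 1)%R; e 3 1; e 3 2; e 3 3]>>%VS)
    = [&& a == d, b == 0, c == 0, l == 0 & f == 0].
Proof. mem_span_coefs [:: d; g; h; k]. Qed.
Lemma mem_S3 : (X \in <<[:: e 2 1; e 3 1; e 3 2; (e 2 2 + e 3 3)%R]>>%VS)
    = [&& a == 0, b == 0, c == 0, f == 0 & l == k].
Proof. mem_span_coefs [:: d; g; h; k]. Qed.
Lemma mem_S4 : (X \in <<[:: e 2 1; e 3 1; (e 3 2 + e 2 3)%R; (e 2 2 + e 3 3)%R]>>%VS)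
    = [&& a == 0, b == 0, c == 0, f == h & l == k].
Proof. mem_span_coefs [:: d; g; h; k]. Qed.
Lemma mem_S5 : (X \in <<[:: e 2 1; e 3 1; e 3 2; (e 1 1 + e 3 3)%R]>>%VS)
    = [&& b == 0, c == 0, l == 0, f == 0 & a == k].
Proof. mem_span_coefs [:: d; g; h; k]. Qed.
Lemma mem_S6 : (X \in <<[:: e 2 1; e 3 1; e 3 2; e 2 2]>>%VS)
    = [&& a == 0, b == 0, c == 0, f == 0 & k == 0].
Proof. mem_span_coefs [:: d; g; h; l]. Qed.
Lemma mem_S7 : (X \in <<[:: e 2 1; (e 1 1 + e 3 1)%R; (e 1 2 + e 3 2)%R; e 2 2]>>%VS)
    = [&& a == g, b == h, c == 0, f == 0 & k == 0].
Proof. mem_span_coefs [:: d; g; h; l]. Qed.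
End Membership.

Definition mem_spanE :=
  (mem_M1, mem_M2, mem_S1, mem_S2, mem_S3, mem_S4, mem_S5, mem_S6, mem_S7).

(** * The nine decompositions *)

Ltac solve_eqs := do ?[apply/andP; split]; apply/eqP; ring.
Ltac solve_subalgebra :=
  let X := fresh "X" in let Y := fresh "Y" in
  intros X Y; case: (mx3P X) => ? ? ? ? ? ? ? ? ?;
  case: (mx3P Y) => ? ? ? ? ? ? ? ? ?; rewrite mx3_opE !mem_spanE;
  (do ?[case/andP=> /eqP->]); move/eqP=> ->;
  (do ?[case/andP=> /eqP->]); move/eqP=> ->; solve_eqs.
(** [s] maps the entries of a matrix to its component in S; the difference is
    then checked to satisfy the equations of M. *)
Ltac split_into_summands s :=
  let X := fresh "X" in
  intros X; case: (mx3P X) => ? ? ? ? ? ? ? ? ?;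
  match goal with |- context [mx3 ?a ?b ?c ?d ?l ?f ?g ?h ?k] =>
    exists (s a b c d l f g h k) end;
  rewrite ?mx3_opE mem_spanE; solve_eqs.
Section Validity.
Context (F : fieldType).

(** Spanning families of sizes 4 and 5 that together generate a space of
    dimension 9 are bases, and their spans meet trivially. *)
Lemma complement_of_sum (L1 L2 : seq 'M[F]_3) :
  size L1 = 4%N -> size L2 = 5%N ->
  (forall X, X \in (<<L1>> + <<L2>>)%VS) ->
  [/\ (<<L1>> + <<L2>>)%VS = fullv, (<<L1>> :&: <<L2>>)%VS = 0%VS,
      \dim <<L1>> = 4%N & \dim <<L2>> = 5%N].
Proof.
move=> sz1 sz2 full.
have eqf : (<<L1>> + <<L2>>)%VS = fullv.
  by apply/vspaceP => X; rewrite full memvf.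
have := dimv_sum_cap <<L1>> <<L2>>; rewrite eqf dimvf /= => dims.
have d1 := dim_span L1; have d2 := dim_span L2.
rewrite sz1 in d1; rewrite sz2 in d2.
have : (9 + \dim (<<L1>> :&: <<L2>>) = \dim <<L1>> + \dim <<L2>>)%N by [].
move: d1 d2; move: (\dim <<L1>>) (\dim <<L2>>) => m n d1 d2 dims'.
have [-> -> /eqP] : [/\ m = 4, n = 5 & \dim (<<L1>> :&: <<L2>>) = 0]%N.
  have le9 := leq_add d1 d2; rewrite -dims' /= in le9.
  have d0 : \dim (<<L1>> :&: <<L2>>) = 0%N.
    by apply/eqP; rewrite -leqn0 -(leq_add2l 9).
  move: dims'; rewrite d0; clear -d1 d2.
  by move: m n d1 d2 => [|[|[|[|[|m]]]]] [|[|[|[|[|[|n]]]]]].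
by rewrite dimv_eq0 => /eqP.
Qed.

Lemma decompositionsB_valid (i : 'I_9) :
  direct_decomposition (tnth (decompositionsB F) i) /\
        nonunital_4_5 (tnth (decompositionsB F) i).
Proof.
have valid L1 L2 : size L1 = 4%N -> size L2 = 5%N ->
    subalgebra <<L1>>%VS -> subalgebra <<L2>>%VS ->
    (forall X : 'M[F]_3, exists2 Y, Y \in <<L1>>%VS & X - Y \in <<L2>>%VS) ->
    1%:M \notin <<L1>>%VS -> 1%:M \notin <<L2>>%VS ->
    direct_decomposition (spans L1 L2) /\ nonunital_4_5 (spans L1 L2).
  move=> sz1 sz2 sub1 sub2 full n1 n2.
  have [|full' cap0 d1 d2] := complement_of_sum sz1 sz2; last by split; split.
  move=> X; have [Y L1Y L2XY] := full X.
  by rewrite -(subrK Y X) addrC memv_add.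
case: i => [[|[|[|[|[|[|[|[|[|i]]]]]]]]] Hi] //; rewrite (tnth_nth (0, 0)%VS) /=;
  apply: valid => //; try solve_subalgebra;
  try by rewrite mx3_opE mem_spanE ?oner_eq0 ?andbF // eq_sym oner_eq0.
- split_into_summands (fun a b c d l f g h k : F => mx3 0 0 0 d 0 0 g h k).
- split_into_summands (fun a b c d l f g h k : F => mx3 d 0 0 d 0 0 g h k).
- split_into_summands (fun a b c d l f g h k : F => mx3 0 0 0 d k 0 g h k).
- split_into_summands (fun a b c d l f g h k : F => mx3 0 0 0 d k h g h k).
- split_into_summands (fun a b c d l f g h k : F => mx3 k 0 0 d 0 0 g h k).
- split_into_summands (fun a b c d l f g h k : F => mx3 0 0 0 d l 0 g h 0).
- split_into_summands (fun a b c d l f g h k : F => mx3 g h 0 d l 0 g h 0).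
- split_into_summands (fun a b c d l f g h k : F => mx3 0 0 0 d l 0 g h l).
- split_into_summands (fun a b c d l f g h k : F => mx3 0 0 0 d l h g h l).
Qed.
End Validity.

(** * Invariants under automorphisms and antiautomorphisms *)

Section Invariants.
Context (F : fieldType).
Implicit Types (D : {vspace 'M[F]_3} * {vspace 'M[F]_3}) (f : 'End('M[F]_3)).

(** An antiautomorphism exchanges left and right annihilators, hence the
    disjunction; the same happens in [S_annihilates_commutators]. *)
Definition M_has_annihilator D :=
  exists2 X : 'M[F]_3, X != 0 &
    (forall Y, Y \in D.2 -> X *m Y = 0) \/ (forall Y, Y \in D.2 -> Y *m X = 0).

Definition S_trace_square (n : nat) D :=
  forall X, X \in D.1 -> \tr (X *m X) *+ n = (\tr X) ^+ 2.

Definition S_annihilates_commutators D :=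
  (forall X Y Z, X \in D.1 -> Y \in D.1 -> Z \in D.1 ->
     (X *m Y - Y *m X) *m Z = 0) \/
  (forall X Y Z, X \in D.1 -> Y \in D.1 -> Z \in D.1 ->
     Z *m (X *m Y - Y *m X) = 0).

Definition invariants : 4.-tuple (_ -> Prop) :=
  [tuple M_has_annihilator; S_trace_square 1; S_trace_square 2;
         S_annihilates_commutators].

(** A functional that vanishes on commutators kills e_ij for distinct i and j
    and takes the same value on all e_ii, hence is a multiple of the trace.
    This makes the trace invariant under both kinds of maps. *)
Lemma trace_unique_on_commutators (l : {scalar 'M[F]_3}) :
  (forall X Y, l (X *m Y) = l (Y *m X)) -> l 1%:M = 3%:R -> 3%:R != 0 :> F ->
  forall X, l X = \tr X.
Proof.
move=> lC l1 n3.
have l0 i j : i != j -> l (delta_mx i j) = 0.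
  move=> ij; rewrite -(mul_delta_mx i i j) lC mul_delta_mx_0 ?linear0 //.
  by rewrite eq_sym.
have l2 i j : l (delta_mx i i) = l (delta_mx j j).
  by rewrite -(mul_delta_mx j i i) lC mul_delta_mx.
have lX X : l X = l (delta_mx 0 0) * \tr X.
  rewrite {1}(matrix_sum_delta X) linear_sum mulr_sumr; apply: eq_bigr => i _.
  rewrite linear_sum (bigD1 i) //= big1 ?addr0 => [|j ji].
    by rewrite linearZ /= (l2 i 0) mulrC.
  by rewrite linearZ /= l0 ?mulr0 // eq_sym.
move=> X; rewrite lX; suff -> : l (delta_mx 0 0) = 1 by rewrite mul1r.
by move: l1; rewrite lX mxtrace1 => /(canRL (mulfK n3)) ->; rewrite divff.
Qed.

Lemma auto_or_anti_bij f : automorphism f \/ antiautomorphism f -> bijective f.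
Proof. by case=> -[]. Qed.

Lemma auto_or_anti1 f : automorphism f \/ antiautomorphism f -> f 1%:M = 1%:M.
Proof.
case=> [[] // | [[g fK gK] fM]].
by rewrite -[LHS]mul1mx -{1}(gK 1%:M) -fM mul1mx gK.
Qed.

Lemma auto_or_anti_tr f : 3%:R != 0 :> F ->
  automorphism f \/ antiautomorphism f -> forall X, \tr (f X) = \tr X.
Proof.
move=> n3 ff X; have f1 := auto_or_anti1 ff.
pose l : {scalar 'M[F]_3} := @mxtrace F 3 \o f.
apply: (trace_unique_on_commutators (l := l)) n3 X; last by rewrite /= f1 mxtrace1.
by move=> X Y /=; case: ff => [[_ _ fM] | [_ fM]]; rewrite !fM mxtrace_mulC.
Qed.

Lemma forall_img f (V : {vspace 'M[F]_3}) (P : 'M[F]_3 -> Prop) :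
  (forall Y, Y \in (f @: V)%VS -> P Y) <-> (forall X, X \in V -> P (f X)).
Proof.
split=> [H X VX | H Y /memv_imgP[X VX ->]]; last exact: H.
by apply: H; apply: memv_img.
Qed.

Lemma auto_or_anti_inv f : automorphism f \/ antiautomorphism f ->
  exists2 g, automorphism g \/ antiautomorphism g &
             forall D, act g (act f D) = D.
Proof.
move=> ff; have injf := bij_inj (auto_or_anti_bij ff).
have ker0 : lker f == 0%VS by apply/lker0P.
have fK : cancel f (f^-1)%VF by exact: lker0_lfunK.
have fVK : cancel (f^-1)%VF f by exact: lker0_lfunVK.
exists (f^-1)%VF; last first.
  by move=> [S M]; rewrite /act /= -!limg_comp lker0_compVf // !lim1g.
have bijV : bijective (f^-1)%VF by exists f.
case: ff => [[_ f1 fM] | [_ fM]]; [left | right]; split=> //.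
- by rewrite -{1}f1 fK.
- by move=> X Y; apply: injf; rewrite fM !fVK.
- by move=> X Y; apply: injf; rewrite fM !fVK.
Qed.

Lemma invariants_act_sub f D (k : 'I_4) : 3%:R != 0 :> F ->
  automorphism f \/ antiautomorphism f ->
  tnth invariants k D -> tnth invariants k (act f D).
Proof.
move=> n3 ff; have trf := auto_or_anti_tr n3 ff.
have injf := bij_inj (auto_or_anti_bij ff).
have f0 X : f X = 0 -> X = 0 by move=> fX0; apply: injf; rewrite fX0 linear0.
have trsq n : S_trace_square n D -> S_trace_square n (act f D).
  move=> sq; apply/forall_img => X SX; rewrite trf -(sq X SX).
  by case: ff => [[_ _ fM] | [_ fM]]; rewrite -fM trf.
case: k => [[|[|[|[|k]]]] Hk] //; rewrite !(tnth_nth (fun=> True)) /=;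
  try exact: trsq.
- case=> X X0 ann; exists (f X).
    by apply: contraNneq X0 => /f0 ->.
  case: ff => [[_ _ fM] | [_ fM]]; case: ann => ann;
    [left | right | right | left]; apply/forall_img => Y MY;
    by rewrite -fM ann ?linear0.
- case: ff => [[_ _ fM] | [_ fM]] -[] comm0; [left | right | right | left];
    move=> _ _ _ /memv_imgP[X SX ->] /memv_imgP[Y SY ->] /memv_imgP[Z SZ ->];
    by rewrite -!fM -linearB -fM comm0 ?linear0.
Qed.

Lemma invariants_act f D (k : 'I_4) : 3%:R != 0 :> F ->
  automorphism f \/ antiautomorphism f ->
  tnth invariants k (act f D) <-> tnth invariants k D.
Proof.
move=> n3 ff; split; last exact: invariants_act_sub.
have [g gg gK] := auto_or_anti_inv ff.
by move=> /(invariants_act_sub n3 gg); rewrite gK.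
Qed.

Definition invariant_table (i : 'I_9) : seq bool :=
  nth [::] [:: [:: true;  true;  false; false];
               [:: true;  false; false; false];
               [:: true;  false; true;  true];
               [:: true;  false; false; true];
               [:: true;  false; true;  false];
               [:: false; true;  false; false];
               [:: false; false; false; false];
               [:: false; false; true;  true];
               [:: false; false; false; true]] i.

Lemma invariant_table_inj : injective invariant_table.
Proof.
move=> i j /eqP; apply: contraTeq; move: i j.
by do 2 case=> [[|[|[|[|[|[|[|[|[|?]]]]]]]]] ?] //.
Qed.

Lemma M1_annihilator (S : {vspace 'M[F]_3}) : M_has_annihilator (S, M1 F).
Proof.
exists (e F 1 3).
  by apply/eqP; rewrite !mx3E => /mx3_inj [] /eqP; rewrite oner_eq0.
left=> Y; case: (mx3P Y) => ? ? ? ? ? ? ? ? ?; rewrite mem_M1.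
by case/and4P=> /eqP-> /eqP-> /eqP-> /eqP->; rewrite !mx3E; congr mx3; ring.
Qed.

Lemma M2_annihilator (S : {vspace 'M[F]_3}) : ~ M_has_annihilator (S, M2 F).
Proof.
have [M11 M12 M23 M33] : [/\ e F 1 1 \in M2 F, e F 1 2 \in M2 F,
    e F 2 3 \in M2 F & e F 3 3 \in M2 F].
  by split; apply: memv_span; rewrite !inE eqxx ?orbT.
case=> X; case: (mx3P X) => ? ? ? ? ? ? ? ? ? /eqP X0 [] /= ann; apply: X0;
  move: (ann _ M11) (ann _ M12) (ann _ M23) (ann _ M33);
  rewrite !mx3E !(mulr0, mulr1, mul0r, mul1r, addr0, add0r);
  move=> /mx3_inj E1 /mx3_inj E2 /mx3_inj E3 /mx3_inj E4;
  by case: E1 => *; case: E2 => *; case: E3 => *; case: E4 => *; subst.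
Qed.

(** The differences that refute the trace identities are 1, 4 or -2; bringing
    them all to 4 leaves only the invertibility of 2 to use. *)
Lemma neq_of_scaled_difference (l r c : F) :
  2%:R != 0 :> F -> (l - r) * c = 2%:R * 2%:R -> l <> r.
Proof.
move=> n2 eq4 lr; move/eqP: eq4.
by rewrite lr subrr mul0r eq_sym mulf_eq0 orbb (negPf n2).
Qed.

(** This lemma and the next one put the memberships in the syntactic form on
    which the equations of the spaces rewrite. *)
Lemma S_trace_squareE n (L M : seq 'M[F]_3) :
  S_trace_square n (spans L M) <->
  forall X : 'M[F]_3, X \in <<L>>%VS -> \tr (X *m X) *+ n = (\tr X) ^+ 2.
Proof. by []. Qed.

Lemma S_annihilates_commutatorsE (L M : seq 'M[F]_3) :
  S_annihilates_commutators (spans L M) <->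
  (forall X Y Z : 'M[F]_3, X \in <<L>>%VS -> Y \in <<L>>%VS -> Z \in <<L>>%VS ->
     (X *m Y - Y *m X) *m Z = 0) \/
  (forall X Y Z : 'M[F]_3, X \in <<L>>%VS -> Y \in <<L>>%VS -> Z \in <<L>>%VS ->
     Z *m (X *m Y - Y *m X) = 0).
Proof. by []. Qed.

Lemma mx3_neq0 (a b c d l f g h k : F) (A := mx3 a b c d l f g h k : 'M[F]_3) :
  has (predC1 0) [:: a; b; c; d; l; f; g; h; k] -> A <> 0.
Proof. by rewrite mx3_0 => nz /mx3_inj eqs; move: nz; rewrite eqs /= !eqxx. Qed.

(* Elements of the spaces S_i on which the identities fail. *)
Let E21 : 'M[F]_3 := mx3 0 0 0 1 0 0 0 0 0.
Let E22 : 'M[F]_3 := mx3 0 0 0 0 1 0 0 0 0.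
Let E31 : 'M[F]_3 := mx3 0 0 0 0 0 0 1 0 0.
Let E32 : 'M[F]_3 := mx3 0 0 0 0 0 0 0 1 0.
Let E33 : 'M[F]_3 := mx3 0 0 0 0 0 0 0 0 1.
Let E11_21 : 'M[F]_3 := mx3 1 0 0 1 0 0 0 0 0.
Let E11_31 : 'M[F]_3 := mx3 1 0 0 0 0 0 1 0 0.
Let E11_33 : 'M[F]_3 := mx3 1 0 0 0 0 0 0 0 1.
Let E22_33 : 'M[F]_3 := mx3 0 0 0 0 1 0 0 0 1.
Let E23_32 : 'M[F]_3 := mx3 0 0 0 0 0 1 0 1 0.

Ltac unfold_witnesses :=
  rewrite /E21 /E22 /E31 /E32 /E33 /E11_21 /E11_31 /E11_33 /E22_33 /E23_32 ?mx3_add.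

Ltac prove_trace_identity :=
  apply: (proj2 (S_trace_squareE _ _ _));
  let X := fresh in intros X; case: (mx3P X) => ? ? ? ? ? ? ? ? ?; rewrite mem_spanE;
    (do ?[case/andP=> /eqP->]); move/eqP=> ->; rewrite mx3_mul !mx3_trace; ring.
Ltac refute_trace_identity w c :=
  let H := fresh in move/(proj1 (S_trace_squareE _ _ _)) => H;
  have {H} := H w; unfold_witnesses;
  rewrite mem_spanE ?(addr0, add0r) !eqxx mx3_mul !mx3_trace => /(_ isT) H;
  apply: False_ind; apply: (@neq_of_scaled_difference _ _ c _ _ H) => //; ring.

Ltac prove_commutator_identity :=
  apply: (proj2 (S_annihilates_commutatorsE _ _));
  let X := fresh in let Y := fresh in let Z := fresh in
  left; intros X Y Z;
  case: (mx3P X) => ? ? ? ? ? ? ? ? ?;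
  case: (mx3P Y) => ? ? ? ? ? ? ? ? ?;
  case: (mx3P Z) => ? ? ? ? ? ? ? ? ?; rewrite !mem_spanE;
  do 3 ((do ?[case/andP=> /eqP->]); move/eqP=> ->);
  rewrite !mx3_opE; congr mx3; ring.
(** The first triple refutes [X,Y] Z = 0 and the second one Z [X,Y] = 0. *)
Ltac refute_commutator_identity X Y Z X' Y' Z' :=
  case/(proj1 (S_annihilates_commutatorsE _ _)) => [/(_ X Y Z) | /(_ X' Y' Z')];
  let H := fresh in intros H; exfalso; move: H; unfold_witnesses;
  rewrite !mem_spanE !eqxx ?oner_eq0 => /(_ isT isT isT);
  rewrite !(mx3_mul, mx3_add, mx3_opp); apply: mx3_neq0;
  rewrite /= !(mulr0, mulr1, mul0r, mul1r, add0r, addr0, oppr0, subr0, sub0r,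
               oppr_eq0, oner_eq0, eqxx) /= ?orbT //.

Lemma invariant_tableP (i : 'I_9) (k : 'I_4) : 2%:R != 0 :> F ->
  tnth invariants k (tnth (decompositionsB F) i) <-> nth false (invariant_table i) k.
Proof.
move=> n2.
case: k => [[|[|[|[|k]]]] Hk] //; rewrite (tnth_nth (fun=> True)) /=.
- case: i => [[|[|[|[|[|[|[|[|[|i]]]]]]]]] Hi] //; rewrite (tnth_nth (0, 0)%VS) /=;
  by split=> //; first [by move/M2_annihilator | by move=> _; exact: M1_annihilator].
- case: i => [[|[|[|[|[|[|[|[|[|i]]]]]]]]] Hi] //;
  rewrite (tnth_nth (0, 0)%VS) /=; split=> //.
  + move=> _; prove_trace_identity.
  + refute_trace_identity (E11_21 + E33) (-(2%:R) : F).
  + refute_trace_identity E22_33 (-(2%:R) : F).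
  + refute_trace_identity E22_33 (-(2%:R) : F).
  + refute_trace_identity E11_33 (-(2%:R) : F).
  + move=> _; prove_trace_identity.
  + refute_trace_identity (E11_31 + E22) (-(2%:R) : F).
  + refute_trace_identity E22_33 (-(2%:R) : F).
  + refute_trace_identity E22_33 (-(2%:R) : F).
- case: i => [[|[|[|[|[|[|[|[|[|i]]]]]]]]] Hi] //;
  rewrite (tnth_nth (0, 0)%VS) /=; split=> //.
  + refute_trace_identity E33 (4%:R : F).
  + refute_trace_identity E33 (4%:R : F).
  + move=> _; prove_trace_identity.
  + refute_trace_identity E23_32 (1 : F).
  + move=> _; prove_trace_identity.
  + refute_trace_identity E22 (4%:R : F).
  + refute_trace_identity E22 (4%:R : F).
  + move=> _; prove_trace_identity.
  + refute_trace_identity E23_32 (1 : F).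
- case: i => [[|[|[|[|[|[|[|[|[|i]]]]]]]]] Hi] //;
  rewrite (tnth_nth (0, 0)%VS) /=; split=> //.
  + refute_commutator_identity E32 E33 E21 E32 E33 E33.
  + refute_commutator_identity E31 E33 E11_21 E31 E33 E33.
  + move=> _; prove_commutator_identity.
  + move=> _; prove_commutator_identity.
  + refute_commutator_identity E32 E11_33 E21 E32 E11_33 E11_33.
  + refute_commutator_identity E32 E22 E21 E21 E22 E22.
  + refute_commutator_identity E21 E22 E11_31 E21 E22 E22.
  + move=> _; prove_commutator_identity.
  + move=> _; prove_commutator_identity.
Qed.

Lemma decompositionsB_inequivalent (i j : 'I_9) :
  2%:R != 0 :> F -> 3%:R != 0 :> F -> i != j ->
  ~ exists f : 'End('M[F]_3), (automorphism f \/ antiautomorphism f) /\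
      act f (tnth (decompositionsB F) i) = tnth (decompositionsB F) j.
Proof.
move=> n2 n3 ij [f [ff fij]]; move/eqP: ij; apply.
apply: invariant_table_inj; apply: (@eq_from_nth _ false).
  by move: i j {fij}; do 2 case=> [[|[|[|[|[|[|[|[|[|?]]]]]]]]] ?] //.
have sz (a : 'I_9) : size (invariant_table a) = 4%N.
  by case: a => [[|[|[|[|[|[|[|[|[|?]]]]]]]]] ?].
move=> k; rewrite sz => k4.
apply/idP/idP => /(invariant_tableP _ (Ordinal k4) n2) inv;
  apply/(invariant_tableP _ (Ordinal k4) n2).
  by rewrite -fij invariants_act.
by move: inv; rewrite -fij invariants_act.
Qed.
End Invariants.

(** * The action on decompositions *)

Section Equivalence.
Context (F : fieldType).
Implicit Types (D : {vspace 'M[F]_3} * {vspace 'M[F]_3}) (f : 'End('M[F]_3)).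

Definition valid45 D := direct_decomposition D /\ nonunital_4_5 D.

Definition classified D :=
  exists (i : 'I_9) (phi : 'End('M[F]_3)),
    automorphism phi /\
    (act phi D = tnth (decompositionsB F) i \/
     act (transpose F \o phi)%VF D = tnth (decompositionsB F) i).

Lemma act_comp f f' D : act (f \o f')%VF D = act f (act f' D).
Proof. by rewrite /act /= !limg_comp. Qed.

Lemma lfun_comp_bij f f' : bijective f -> bijective f' -> bijective (f \o f')%VF.
Proof.
move=> [g fK gK] [g' fK' gK'].
by exists (g' \o g) => X; rewrite lfunE /= ?fK ?fK' ?gK' ?gK.
Qed.

Lemma auto_or_anti_comp f f' :
  automorphism f \/ antiautomorphism f ->
  automorphism f' \/ antiautomorphism f' ->
  automorphism (f \o f')%VF \/ antiautomorphism (f \o f')%VF.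
Proof.
move=> ff ff'.
have bij := lfun_comp_bij (auto_or_anti_bij ff) (auto_or_anti_bij ff').
have comp1 : (f \o f')%VF 1%:M = 1%:M by rewrite lfunE /= !auto_or_anti1.
case: ff ff' => [[_ _ fM] | [_ fM]] [[_ _ fM'] | [_ fM']];
  [left | right | right | left]; split=> // X Y; by rewrite !lfunE /= fM' fM.
Qed.

Lemma transposeE X : transpose F X = X^T.
Proof. by rewrite lfunE. Qed.

Lemma transpose_anti : antiautomorphism (transpose F).
Proof.
split; first by exists (transpose F) => X; rewrite !transposeE trmxK.
by move=> X Y; rewrite !transposeE trmx_mul.
Qed.

Lemma transposeK f : (transpose F \o (transpose F \o f))%VF = f.
Proof. by apply/lfunP => X; rewrite !comp_lfunE !transposeE trmxK. Qed.

(** An antiautomorphism is the transpose composed with an automorphism, so the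
    two alternatives in [classified] amount to allowing either kind of map. *)
Lemma classified_intro f (i : 'I_9) D :
  automorphism f \/ antiautomorphism f ->
  act f D = tnth (decompositionsB F) i -> classified D.
Proof.
move=> ff fD; exists i; case: (ff) => [f_auto | [_ fM]].
  by exists f; split=> //; left.
exists (transpose F \o f)%VF; rewrite transposeK; split; last by right.
have [[] // | [bij _]] :=
  auto_or_anti_comp (or_intror transpose_anti) ff.
split=> // [|X Y]; first by rewrite comp_lfunE transposeE (auto_or_anti1 ff) trmx1.
by rewrite !comp_lfunE fM !transposeE trmx_mul.
Qed.

Lemma valid45_act f D : automorphism f \/ antiautomorphism f ->
  valid45 D -> valid45 (act f D).
Proof.
move=> ff [[subS subM full cap0] [dS dM nS nM]].
have injf := bij_inj (auto_or_anti_bij ff); have f1 := auto_or_anti1 ff.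
have ker0 : lker f == 0%VS by apply/lker0P.
have sub V : subalgebra V -> subalgebra (f @: V)%VS.
  move=> subV _ _ /memv_imgP[X VX ->] /memv_imgP[Y VY ->].
  by case: ff => [[_ _ fM] | [_ fM]]; rewrite -fM memv_img // subV.
have dim V : \dim (f @: V) = \dim V.
  by rewrite limg_dim_eq //; apply/eqP; rewrite (eqP ker0) capv0.
have unit (V : {vspace 'M[F]_3}) : 1%:M \notin V -> 1%:M \notin (f @: V)%VS.
  apply: contra => /memv_imgP[X VX]; rewrite -{1}f1 => /injf ->; exact: VX.
split; split; rewrite /= ?dim //; try exact: sub; try exact: unit.
- by rewrite -limgD full lker0_limgf.
- by rewrite -lker0_img_cap // cap0 limg0.
Qed.

Lemma classified_act f D : automorphism f \/ antiautomorphism f ->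
  classified (act f D) -> classified D.
Proof.
move=> ff [i [phi [phi_auto]]].
have comp g : automorphism g \/ antiautomorphism g ->
    act g (act f D) = tnth (decompositionsB F) i -> classified D.
  rewrite -act_comp => gg; apply: classified_intro.
  exact: auto_or_anti_comp.
case; apply: comp; first by left.
by apply: auto_or_anti_comp; [right; exact: transpose_anti | left].
Qed.

Definition conj_by (g h : 'M[F]_3) : 'End('M[F]_3) :=
  linfun (mulmxr h \o mulmx g).

Lemma conj_byE g h X : conj_by g h X = g *m X *m h.
Proof. by rewrite lfunE. Qed.

Lemma conj_by_auto g h : g *m h = 1%:M -> automorphism (conj_by g h).
Proof.
move=> gh; have hg := mulmx1C gh; split.
- by exists (conj_by h g) => X; rewrite !conj_byE !mulmxA ?gh ?hg mul1mx
    -mulmxA ?gh ?hg mulmx1.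
- by rewrite conj_byE mulmx1.
- by move=> X Y; rewrite !conj_byE !mulmxA -(mulmxA (g *m X) h g) hg mulmx1.
Qed.

Lemma mem_conj_by g h (V : {vspace 'M[F]_3}) X : g *m h = 1%:M ->
  (X \in (conj_by g h @: V)%VS) = (h *m X *m g \in V).
Proof.
move=> gh; have hg := mulmx1C gh; apply/memv_imgP/idP => [[Y VY ->] | VX].
  by rewrite conj_byE !mulmxA hg mul1mx -mulmxA hg mulmx1.
exists (h *m X *m g) => //.
by rewrite conj_byE !mulmxA gh mul1mx -mulmxA gh mulmx1.
Qed.

Lemma dim_conj_by g h (V : {vspace 'M[F]_3}) : g *m h = 1%:M ->
  \dim (conj_by g h @: V) = \dim V.
Proof.
move=> gh; apply: limg_dim_eq; apply/eqP; rewrite -subv0.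
have /lker0P/eqP -> : injective (conj_by g h).
  by case: (conj_by_auto gh) => /bij_inj.
by rewrite capvSr.
Qed.

Lemma eq_span_dim (L : seq 'M[F]_3) (V : {vspace 'M[F]_3}) :
  \dim V = \dim <<L>> -> (forall X, X \in L -> X \in V) -> V = <<L>>%VS.
Proof.
move=> dimV LV; apply/esym/eqP; rewrite eqEdim dimV leqnn andbT.
by apply/span_subvP => X /LV.
Qed.

End Equivalence.

(** * An idempotent of rank 2 in M *)

Section Trace.
Context (F : fieldType).
Context (two_neq0 : 2%:R != 0 :> F).
Implicit Types (X Y : 'M[F]_3).

(** Stated for any injective [phi] so as to apply to [mxvec] and to [mxvec]
    after transposition: the trace form is the dot product of these two. *)
Lemma rank_rows_free n (b : n.-tuple 'M[F]_3)
    (phi : {linear 'M[F]_3 -> 'rV[F]_(3 * 3)}) :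
  injective phi -> free b -> \rank (\matrix_i phi (tnth b i)) = n.
Proof.
move=> phi_inj free_b; apply/eqP; rewrite -/(row_free _) -kermx_eq0.
apply/rowV0P => u /sub_kermxP; rewrite mulmx_sum_row => u0.
apply/rowP => i; rewrite mxE.
have indep := freeP free_b (u 0); suff : \sum_j u 0 j *: b`_j = 0 by move/indep.
apply: phi_inj; rewrite linear0 -[RHS]u0 linear_sum; apply: eq_bigr => j _.
by rewrite linearZ rowK (tnth_nth 0).
Qed.

(** The trace form is nondegenerate: bases of orthogonal spaces give matrices
    with nine columns and nine rows whose product is zero, so the ranks add up
    to at most 9. *)
Lemma trace_form_orthogonal (V W : {vspace 'M[F]_3}) :
  (forall X Y, X \in V -> Y \in W -> \tr (X *m Y) = 0) ->
  (\dim V + \dim W <= 9)%N.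
Proof.
move=> orth; have fV := basis_free (vbasisP V); have fW := basis_free (vbasisP W).
pose phiW : {linear 'M[F]_3 -> 'rV[F]_(3 * 3)} := mxvec \o trmx.
have rV := @rank_rows_free _ (vbasis V) mxvec (can_inj mxvecK) fV.
have rW := @rank_rows_free _ (vbasis W) phiW
  (inj_comp (can_inj mxvecK) (@trmx_inj _ _ _)) fW.
set A := (\matrix_i _ : 'M_(_, 3 * 3)) in rV; set B := (\matrix_i _) in rW.
suff AB0 : A *m B^T = 0.
  by have := mulmx0_rank_max AB0; rewrite mxrank_tr rV rW.
apply/matrixP => i j; rewrite !mxE.
rewrite -[RHS](orth (tnth (vbasis V) i) (tnth (vbasis W) j));
  try by rewrite vbasis_mem ?mem_tnth.
rewrite (reindex _ (curry_mxvec_bij _ _)) /= /mxtrace.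
under [RHS]eq_bigr do rewrite mxE.
rewrite [RHS]pair_bigA; apply: eq_bigr => -[a b] _ /=.
by rewrite !mxE !mxvecE !mxE.
Qed.

(** Gaussian elimination gives E = L D U with D = pid_mx r.  Then U E U^-1 is
    N D with N = U L, and D N D = D means that N D = D + K where K maps the
    image of D into its kernel; conjugation by 1 - K removes K. *)
Lemma idempotent_conj n (E : 'M[F]_n) : E *m E = E ->
  exists g h : 'M[F]_n, g *m h = 1%:M /\ g *m E *m h = pid_mx (\rank E).
Proof.
move=> EE; set D : 'M[F]_n := pid_mx (\rank E).
pose L := col_ebase E; pose U := row_ebase E.
have uL : L \in unitmx := col_ebase_unit E.
have uU : U \in unitmx := row_ebase_unit E.
have LDU : L *m D *m U = E := mulmx_ebase E.
have DD : D *m D = D by rewrite /D pid_mx_id // rank_leq_row.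
pose N := U *m L.
have DND : D *m N *m D = D.
  have : L *m (D *m N *m D) *m U = L *m D *m U.
    by rewrite LDU -[RHS]EE -{1 2}LDU !mulmxA.
  by move/(can_inj (mulmxK uU))/(can_inj (mulKmx uL)).
pose K := (1%:M - D) *m N *m D.
have KD : K *m D = K by rewrite /K -mulmxA DD.
have DK : D *m K = 0 by rewrite /K !mulmxA mulmxBr mulmx1 DD subrr !mul0mx.
have KK : K *m K = 0 by rewrite -{1}KD -mulmxA DK mulmx0.
have ND : N *m D = D + K.
  by rewrite /K -mulmxA mulmxBl mul1mx mulmxA DND addrC subrK.
exists ((1%:M - K) *m U), (invmx U *m (1%:M + K)); split.
  rewrite !mulmxA mulmxK // mulmxDr mulmx1 mulmxBl mul1mx KK subr0.
  by rewrite subrK.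
rewrite -LDU !mulmxA mulmxK // -(mulmxA _ U) -/N -(mulmxA _ N) ND.
have -> : (1%:M - K) *m (D + K) = D.
  by rewrite mulmxBl mul1mx mulmxDr KD KK addr0 addrK.
by rewrite mulmxDr mulmx1 DK addr0.
Qed.

(** Twice the second elementary symmetric function of the eigenvalues. *)
Definition trace_defect X := \tr X ^+ 2 - \tr (X *m X).

Lemma cayley_hamilton3 X : exists d,
  2%:R *: (X *m X *m X) - (2%:R * \tr X) *: (X *m X) + trace_defect X *: X = d%:M.
Proof.
case: (mx3P X) => a b c d e f g h k.
exists (2%:R * (a * (e * k - f * h) - b * (d * k - f * g) + c * (d * h - e * g))).
rewrite -scalemx1 /trace_defect mx3_1 !mx3_mul !mx3_trace !mx3E; congr mx3; ring.
Qed.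

(** If 1 were not in M, then K = M n ker tr, of dimension at least 4, would be
    orthogonal to U = M + <1>, of dimension 6. *)
Lemma unit_of_trace_multiplicative (M : {vspace 'M[F]_3}) :
  \dim M = 5%N ->
  (forall X Y, X \in M -> Y \in M -> \tr (X *m Y) = \tr X * \tr Y) ->
  1%:M \in M.
Proof.
move=> dM trM; apply/negPn/negP => nM.
pose trf : 'Hom('M[F]_3, F^o) := linfun (@mxtrace F 3 : 'M[F]_3 -> F^o).
have trfE X : trf X = \tr X by rewrite lfunE.
pose K := (M :&: lker trf)%VS; pose U := (M + <[1%:M]>)%VS.
have dK : (4 <= \dim K)%N.
  rewrite -(leq_add2r (\dim (trf @: M))) limg_ker_dim dM (leq_add2l 4 _ 1).
  by have := dimvS (subvf (trf @: M)); rewrite dimvf.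
have dU : \dim U = 6%N.
  rewrite dimv_disjoint_sum ?dim_vline ?dM -?mx3_1.
    by rewrite -[_ == 0]negbK oner_neq0.
  apply/eqP; rewrite -subv0; apply/subvP => X.
  rewrite memv_cap => /andP[MX /vlineP[c Xc]]; rewrite memv0 Xc.
  have [-> | c0] := eqVneq c 0; first by rewrite scale0r.
  by case/negP: nM; rewrite -[1%:M](scalerK c0) -Xc memvZ.
suff : (\dim K + \dim U <= 9)%N.
  by rewrite dU => /(leq_trans (leq_add dK (leqnn 6))).
apply: trace_form_orthogonal => X Z.
rewrite memv_cap memv_ker trfE => /andP[MX /eqP trX].
case/memv_addP => Y MY [_ /vlineP[c ->] ->].
rewrite mulmxDr linearD /= trM // -scalemxAr mulmx1 linearZ /= trX.
by rewrite mul0r mulr0 addr0.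
Qed.


(** Polarisation: if the quadratic form vanishes at all b_i and b_i + b_j, the
    trace is multiplicative on M. *)
Lemma exists_trace_defect_neq0 (M : {vspace 'M[F]_3}) :
  \dim M = 5%N -> 1%:M \notin M -> exists2 X, X \in M & trace_defect X != 0.
Proof.
move=> dM nM; pose b := vbasis M.
have [/forallP trb | ] := boolP [forall i : 'I_(\dim M), [forall j : 'I_(\dim M),
    \tr (b`_i *m b`_j) == \tr b`_i * \tr b`_j]].
  case/negP: nM; apply: unit_of_trace_multiplicative => // X Y MX MY.
  rewrite (coord_vbasis MX) (coord_vbasis MY) mulmx_suml !linear_sum mulr_suml.
  apply: eq_bigr => i _; rewrite mulmx_sumr linear_sum mulr_sumr.
  apply: eq_bigr => j _; have /forallP/(_ j)/eqP trij := trb i.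
  by rewrite -scalemxAl -scalemxAr !linearZ /= trij; ring.
case/forallPn => i /forallPn[j].
set X := b`_i; set Y := b`_j => trXY.
have [MX MY] : X \in M /\ Y \in M.
  by split; apply: vbasis_mem; apply: mem_nth; rewrite size_tuple.
have [qX | ] := eqVneq (trace_defect X) 0; last by exists X.
have [qY | ] := eqVneq (trace_defect Y) 0; last by exists Y.
exists (X + Y); rewrite ?memvD //.
have -> : trace_defect (X + Y) = trace_defect X + trace_defect Y
                                 - 2%:R * (\tr (X *m Y) - \tr X * \tr Y).
  by rewrite /trace_defect mulmxDl !mulmxDr !linearD /= (mxtrace_mulC Y X); ring.
by rewrite qX qY addr0 sub0r oppr_eq0 mulf_neq0 // subr_eq0.
Qed.

Lemma mx3_pid2 : pid_mx 2 = mx3 1 0 0 0 1 0 0 0 0 :> 'M[F]_3.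
Proof.
apply/matrixP => i j; rewrite !mxE.
by case: i j => [[|[|[|i]]] Hi] [[|[|[|j]]] Hj].
Qed.

(** The trace determines the rank here, as r = 2 in F for some r <= 3 forces
    r = 2 as soon as 2 is nonzero. *)
Lemma idempotent_trace2 (E : 'M[F]_3) : E *m E = E -> \tr E = 2%:R ->
  exists g h : 'M[F]_3, g *m h = 1%:M /\ g *m E *m h = mx3 1 0 0 0 1 0 0 0 0.
Proof.
move=> EE trE; have [g [h [gh gEh]]] := idempotent_conj EE.
exists g, h; split=> //; rewrite gEh -mx3_pid2; congr pid_mx.
have : \tr (pid_mx (\rank E) : 'M[F]_3) = 2%:R.
  by rewrite -gEh mxtrace_mulC mulmxA (mulmx1C gh) mul1mx.
move: (\rank E) (rank_leq_row E) => [|[|[|[|r]]]] // _;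
  rewrite /mxtrace !big_ord_recl big_ord0 !mxE /= => /esym/eqP.
- by rewrite !addr0 (negPf two_neq0).
- by rewrite !addr0 -subr_eq0 -natrB // oner_eq0.
- by rewrite -subr_eq0 (_ : _ - _ = -1) ?oppr_eq0 ?oner_eq0 //; ring.
Qed.

(** The constant term in the Cayley-Hamilton identity of X is zero because it
    is a scalar matrix in M.  Dividing by the coefficient of X shows that
    E = 2 (tr X X - X^2) / (tr X ^ 2 - tr (X^2)) satisfies X E = X, so E is the
    projection onto the image of X, and it has trace 2. *)
Lemma exists_rank2_idempotent (M : {vspace 'M[F]_3}) X :
  subalgebra M -> 1%:M \notin M -> X \in M -> trace_defect X != 0 ->
  exists g h, g *m h = 1%:M /\ mx3 1 0 0 0 1 0 0 0 0 \in (conj_by g h @: M)%VS.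
Proof.
move=> subM nM MX qX.
have MXX : X *m X \in M by exact: subM.
have [d] := cayley_hamilton3 X.
have [-> | d0] := eqVneq d 0; last first.
  move=> eqd; case/negP: nM; rewrite -[1%:M](scalerK d0) scalemx1 -eqd.
  by rewrite memvZ // !memvD // ?memvN memvZ // subM.
rewrite raddf0 => CH.
pose c := 2%:R / trace_defect X.
pose E := c *: (\tr X *: X - X *m X).
have ME : E \in M by rewrite memvZ // memvB // memvZ.
have XE : X *m E = X.
  rewrite /E -scalemxAr mulmxBr -scalemxAr mulmxA.
  apply: (scalerI qX); rewrite scalerA /c mulrC divfK // scalerBr scalerA.
  by apply/eqP; rewrite eq_sym -subr_eq0 opprB addrCA addrA addrAC CH.
have EE : E *m E = E.
  rewrite {1}/E -scalemxAl mulmxBl -scalemxAl -mulmxA !XE.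
  by rewrite -/E.
have trE : \tr E = 2%:R.
  rewrite /E linearZ linearB /= linearZ /= /c -expr2 -/(trace_defect X) divfK //.
have [g [h [gh gEh]]] := idempotent_trace2 EE trE.
by exists g, h; split=> //; rewrite -gEh -conj_byE memv_img.
Qed.

End Trace.

(** * Two diagonal units in M *)

Section Corner.
Context (F : fieldType).
Implicit Types (X Y : 'M[F]_3).
Implicit Type M : {vspace 'M[F]_3}.

(** M is the whole span of [L] or a hyperplane in it, so every plane <X, Y> in
    that span contains a nonzero element of M. *)
Lemma codim1_meets_plane M (L : seq 'M[F]_3) X Y :
  (M <= <<L>>)%VS -> (size L <= (\dim M).+1)%N -> X \in <<L>>%VS -> Y \in <<L>>%VS ->
  X \in M \/ exists c, Y - c *: X \in M.
Proof.
move=> ML sz LX LY; have [| MX] := boolP (X \in M); [by left | right].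
have X0 : X != 0 by apply: contraNneq MX => ->; rewrite mem0v.
have dMX : \dim (M + <[X]>) = (\dim M).+1.
  rewrite dimv_disjoint_sum ?dim_vline ?X0 ?addn1 //.
  apply/eqP; rewrite -subv0; apply/subvP => Z.
  rewrite memv_cap => /andP[MZ /vlineP[c Zc]]; rewrite memv0 Zc.
  have [-> | c0] := eqVneq c 0; first by rewrite scale0r.
  by case/negP: MX; rewrite -[X](scalerK c0) -Zc memvZ.
have : (M + <[X]> == <<L>>)%VS.
  rewrite eqEdim subv_add ML -memvE LX dMX.
  exact: leq_trans (dim_span _) sz.
move/eqP=> eqL; move: LY; rewrite -eqL => /memv_addP[Z MZ [_ /vlineP[c ->] ->]].
by exists c; rewrite addrK.
Qed.

Lemma line_of_orthogonal (x y u v : F) : (x, y) != (0, 0) -> x * u + y * v = 0 ->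
  exists c, u = c * - y /\ v = c * x.
Proof.
have [-> | x0 _] := eqVneq x 0; last first.
  move=> eq0; exists (v / x); split; last by rewrite divfK.
  apply: (mulfI x0); rewrite (canRL (addrK _) eq0).
  by field.
rewrite xpair_eqE eqxx /= => y0; rewrite mul0r add0r => /eqP.
rewrite mulf_eq0 (negPf y0) => /eqP ->.
by exists (- (u / y)); rewrite mulr0 mulrNN divfK.
Qed.

(** The entry (3,3) vanishes on M, for otherwise M contains e33 and then 1.
    So the rows (Y_31, Y_32) and the columns (Z_13, Z_23) of elements of M,
    which M contains separately, are orthogonal: either all the rows are zero,
    or all the columns are, or each kind spans a line. *)
Lemma corner_cover M : subalgebra M -> 1%:M \notin M ->
  mx3 1 0 0 0 1 0 0 0 0 \in M ->
  exists B C, (M <= <<[:: e F 1 1; e F 1 2; e F 2 1; e F 2 2; B; C]>>)%VS.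
Proof.
move=> subM nM ME; set E := mx3 1 0 0 0 1 0 0 0 0 in ME.
have corner0 a b c d l f g h k : mx3 a b c d l f g h k \in M -> k = 0.
  set X := mx3 a b c d l f g h k => MX; apply/eqP/negPn/negP => k0; case/negP: nM.
  have -> : 1%:M = E + k^-1 *: (X - E *m X - X *m E + E *m X *m E).
    rewrite /E /X !mx3E; congr mx3; try ring.
    by rewrite !(mul0r, mulr0, addr0, subr0) add0r mulVf.
  by rewrite memvD // memvZ // memvD ?memvB // ?subM // subM.
have col a b c d l f g h k :
    mx3 a b c d l f g h k \in M -> mx3 0 0 c 0 0 f 0 0 0 \in M.
  set X := mx3 a b c d l f g h k => MX.
  have -> : mx3 0 0 c 0 0 f 0 0 0 = E *m X - E *m X *m E.
    by rewrite /E /X !mx3E; congr mx3; ring.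
  by rewrite memvB ?subM // subM.
have row a b c d l f g h k :
    mx3 a b c d l f g h k \in M -> mx3 0 0 0 0 0 0 g h 0 \in M.
  set X := mx3 a b c d l f g h k => MX.
  have -> : mx3 0 0 0 0 0 0 g h 0 = X *m E - E *m X *m E.
    by rewrite /E /X !mx3E; congr mx3; ring.
  by rewrite memvB ?subM // subM.
have orth a b c d l f g h k a' b' c' d' l' f' g' h' k' :
    mx3 a b c d l f g h k \in M -> mx3 a' b' c' d' l' f' g' h' k' \in M ->
    g * c' + h * f' = 0.
  move=> /row r /col c'M; have := subM _ _ r c'M; rewrite mx3_mul => /corner0 <-.
  by ring.
have [rows0 | /subvPn[Y MY nY]] := boolP (M <=
    <<[:: e F 1 1; e F 1 2; e F 2 1; e F 2 2; e F 1 3; e F 2 3]>>)%VS.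
  by exists (e F 1 3), (e F 2 3).
have [cols0 | /subvPn[Z MZ nZ]] := boolP (M <=
    <<[:: e F 1 1; e F 1 2; e F 2 1; e F 2 2; e F 3 1; e F 3 2]>>)%VS.
  by exists (e F 3 1), (e F 3 2).
move: MY MZ nY nZ; case: (mx3P Y) => a b c d l f g h k.
case: (mx3P Z) => a' b' c' d' l' f' g' h' k' MY MZ.
have k0 := corner0 _ _ _ _ _ _ _ _ _ MY; have k0' := corner0 _ _ _ _ _ _ _ _ _ MZ.
rewrite {}k0 {}k0' {k k'} in MY MZ *.
have [[-> ->] /negP[] | gh0 _] := eqVneq (g, h) (0, 0).
  apply/mem_spanP; exists [:: a; b; d; l; c; f].
  by rewrite !big_ord_recl big_ord0 /= !mx3E; congr mx3; ring.
have [[-> ->] /negP[] | cf0 _] := eqVneq (c', f') (0, 0).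
  apply/mem_spanP; exists [:: a'; b'; d'; l'; g'; h'].
  by rewrite !big_ord_recl big_ord0 /= !mx3E; congr mx3; ring.
exists (mx3 0 0 (-h) 0 0 g 0 0 0), (mx3 0 0 0 0 0 0 (-f') c' 0).
apply/subvP => X; case: (mx3P X) => x1 x2 x3 x4 x5 x6 x7 x8 x9 MX.
have [x [-> ->]] :=
  line_of_orthogonal gh0 (orth _ _ _ _ _ _ _ _ _ _ _ _ _ _ _ _ _ _ MY MX).
have [|y [-> ->]] := @line_of_orthogonal c' f' x7 x8 cf0.
  by rewrite mulrC (mulrC f') (orth _ _ _ _ _ _ _ _ _ _ _ _ _ _ _ _ _ _ MX MZ).
rewrite (corner0 _ _ _ _ _ _ _ _ _ MX).
apply/mem_spanP; exists [:: x1; x2; x4; x5; x; y].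
by rewrite !big_ord_recl big_ord0 /= !mx3E; congr mx3; ring.
Qed.

(** The plane <e11, e12> meets M, so M contains e11 + x e12, which is conjugate
    to e11 by a matrix commuting with e11 + e22, or else e12; in the latter
    case the plane <e11, e21> meets M too, and the product with e12 gives e11. *)
Lemma exists_conj_diagonal_units M : subalgebra M -> \dim M = 5%N -> 1%:M \notin M ->
  mx3 1 0 0 0 1 0 0 0 0 \in M ->
  exists g h, [/\ g *m h = 1%:M, e F 1 1 \in (conj_by g h @: M)%VS
                & e F 2 2 \in (conj_by g h @: M)%VS].
Proof.
move=> subM dM nM ME; have [B [C ML]] := corner_cover subM nM ME.
set L := [:: _; _; _; _; B; C] in ML.
have plane X Y : X \in L -> Y \in L -> X \in M \/ exists c, Y - c *: X \in M.
  by move=> LX LY; apply: codim1_meets_plane ML _ _ _; rewrite ?dM ?memv_span.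
have inL : [/\ e F 1 1 \in L, e F 1 2 \in L & e F 2 1 \in L].
  by rewrite /L !inE !eqxx ?orbT.
case: inL => L11 L12 L21.
suff [x Mx] : exists x, mx3 1 x 0 0 0 0 0 0 0 \in M.
  exists (mx3 1 x 0 0 1 0 0 0 1), (mx3 1 (-x) 0 0 1 0 0 0 1).
  have gh : mx3 1 x 0 0 1 0 0 0 1 *m mx3 1 (-x) 0 0 1 0 0 0 1 = 1%:M :> 'M[F]_3.
    by rewrite !mx3E; congr mx3; ring.
  split=> //; rewrite mem_conj_by //.
    rewrite (_ : _ *m _ *m _ = mx3 1 x 0 0 0 0 0 0 0) //.
    by rewrite !mx3E; congr mx3; ring.
  rewrite (_ : _ *m _ *m _ =
    mx3 1 0 0 0 1 0 0 0 0 - mx3 1 x 0 0 0 0 0 0 0) ?memvB //.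
  by rewrite !mx3E; congr mx3; ring.
have [M12 | [c Mc]] := plane _ _ L12 L11; last first.
  exists (- c); rewrite (_ : mx3 _ _ _ _ _ _ _ _ _ = e F 1 1 - c *: e F 1 2) //.
  by rewrite !mx3E; congr mx3; ring.
(* Only e12 is known to lie in M: then e11 itself does, so x = 0. *)
exists 0.
have [M21 | [c Mc]] := plane _ _ L21 L11.
  by have := subM _ _ M12 M21; rewrite !mx3E !(mulr0, mul0r, mulr1, addr0, add0r).
have [c0 | c0] := eqVneq c 0.
  by move: Mc; rewrite c0 scale0r subr0 mx3_e.
have -> : mx3 1 0 0 0 0 0 0 0 0 = - c^-1 *: (e F 1 2 *m (e F 1 1 - c *: e F 2 1)).
  by rewrite !mx3E; congr mx3; try ring; field.
by rewrite memvZ // subM.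
Qed.

End Corner.

(** * Subalgebras spanned by matrix units *)

Section Units.
Context (F : fieldType).
Implicit Types (X Y : 'M[F]_3).
Implicit Type M : {vspace 'M[F]_3}.
Local Notation e := (e F).
Local Notation M1 := (M1 F).
Local Notation M2 := (M2 F).

Definition matrix_units : seq 'M[F]_3 :=
  [:: e 1 1; e 1 2; e 1 3; e 2 1; e 2 2; e 2 3; e 3 1; e 3 2; e 3 3].

Lemma mx3_sum_units a b c d l f g h k :
  mx3 a b c d l f g h k = a *: e 1 1 + (b *: e 1 2 + (c *: e 1 3 +
   (d *: e 2 1 + (l *: e 2 2 + (f *: e 2 3 +
   (g *: e 3 1 + (h *: e 3 2 + k *: e 3 3))))))).
Proof. by rewrite !mx3E; congr mx3; ring. Qed.

Lemma free_matrix_units : free matrix_units.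
Proof.
rewrite /free /matrix_units; set U := [:: _; _; _; _; _; _; _; _; _].
suff -> : <<U>>%VS = fullv by rewrite dimvf.
apply/vspaceP => X; rewrite memvf; case: (mx3P X) => *.
by rewrite mx3_sum_units !memvD // memvZ // memv_span // !inE eqxx ?orbT.
Qed.

(** Peirce components for e11, e22 and e33 = 1 - e11 - e22; those for
    e33 are X minus its products with D = e11 + e22, hence lie in M. *)
Lemma unit_components M a b c d l f g h k : subalgebra M ->
  e 1 1 \in M -> e 2 2 \in M -> mx3 a b c d l f g h k \in M ->
  all (mem M) [:: a *: e 1 1; b *: e 1 2; c *: e 1 3; d *: e 2 1; l *: e 2 2;
                  f *: e 2 3; g *: e 3 1; h *: e 3 2; k *: e 3 3].
Proof.
move=> subM M11 M22; set X := mx3 a b c d l f g h k => MX.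
set D := e 1 1 + e 2 2; have MD : D \in M by exact: memvD.
have MDX : D *m X \in M by exact: subM.
have MXD : X *m D \in M by exact: subM.
rewrite /= andbT; do ?[apply/andP; split].
- have -> : a *: e 1 1 = e 1 1 *m X *m e 1 1.
    by rewrite /X !mx3E; congr mx3; ring.
  by rewrite ?subM // subM.
- have -> : b *: e 1 2 = e 1 1 *m X *m e 2 2.
    by rewrite /X !mx3E; congr mx3; ring.
  by rewrite ?subM // subM.
- have -> : c *: e 1 3 = e 1 1 *m X - e 1 1 *m X *m D.
    by rewrite /X /D !mx3E; congr mx3; ring.
  by rewrite memvB ?subM // subM.
- have -> : d *: e 2 1 = e 2 2 *m X *m e 1 1.
    by rewrite /X !mx3E; congr mx3; ring.
  by rewrite ?subM // subM.
- have -> : l *: e 2 2 = e 2 2 *m X *m e 2 2 by rewrite /X !mx3E; congr mx3; ring.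
  by rewrite ?subM // subM.
- have -> : f *: e 2 3 = e 2 2 *m X - e 2 2 *m X *m D.
    by rewrite /X /D !mx3E; congr mx3; ring.
  by rewrite memvB ?subM // subM.
- have -> : g *: e 3 1 = X *m e 1 1 - D *m X *m e 1 1.
    by rewrite /X /D !mx3E; congr mx3; ring.
  by rewrite memvB ?subM // subM.
- have -> : h *: e 3 2 = X *m e 2 2 - D *m X *m e 2 2.
    by rewrite /X /D !mx3E; congr mx3; ring.
  by rewrite memvB ?subM // subM.
have -> : k *: e 3 3 = X - D *m X - X *m D + D *m X *m D.
  by rewrite /X /D !mx3E; congr mx3; ring.
by rewrite memvD // ?memvB // subM.
Qed.

Lemma dim_count_units M : subalgebra M -> e 1 1 \in M -> e 2 2 \in M ->
  \dim M = count (mem M) matrix_units.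
Proof.
move=> subM M11 M22; rewrite -size_filter.
have /eqP <- : free (filter (mem M) matrix_units).
  exact/filter_free/free_matrix_units.
congr (\dim _); apply/eqP; rewrite eqEsubv; apply/andP; split; last first.
  by apply/span_subvP => X; rewrite mem_filter => /andP[].
apply/subvP => X; case: (mx3P X) => a b c d l f g h k MX.
have := unit_components subM M11 M22 MX.
have span1 x u : u \in matrix_units -> x *: u \in M ->
    x *: u \in <<filter (mem M) matrix_units>>%VS.
  have [-> | x0] := eqVneq x 0; first by move=> _ _; rewrite scale0r mem0v.
  move=> Uu Mxu; apply/memvZ/memv_span; rewrite mem_filter Uu andbT /=.
  by rewrite -[u](scalerK x0) memvZ.
rewrite mx3_sum_units /= andbT => /and5P[? ? ? ? /and5P[? ? ? ? ?]].
by rewrite !memvD ?span1 // !inE eqxx ?orbT.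
Qed.

(** The pairs (i,j) with e_ij in M form a transitive relation with five
    elements, two of them being (1,1) and (2,2).  As (3,3) is not one of them,
    3 lies on no cycle, and counting leaves only linear orders. *)
Lemma linear_order_units M : subalgebra M -> \dim M = 5%N -> 1%:M \notin M ->
  e 1 1 \in M -> e 2 2 \in M ->
  [\/ [/\ e 1 2 \in M, e 1 3 \in M & e 2 3 \in M],
      [/\ e 2 1 \in M, e 1 3 \in M & e 2 3 \in M],
      [/\ e 1 2 \in M, e 1 3 \in M & e 3 2 \in M] |
   [\/ [/\ e 2 1 \in M, e 3 1 \in M & e 2 3 \in M],
      [/\ e 1 2 \in M, e 3 1 \in M & e 3 2 \in M] |
      [/\ e 2 1 \in M, e 3 1 \in M & e 3 2 \in M]]].
Proof.
move=> subM dM nM M11 M22.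
have M33 : (e 3 3 \in M) = false.
  apply: contraNF nM => M33.
  have -> : 1%:M = e 1 1 + e 2 2 + e 3 3 by rewrite !mx3E; congr mx3; ring.
  by rewrite !memvD.
have trans X Y Z : X *m Y = Z -> X \in M -> Y \in M -> Z \in M.
  by move=> <-; exact: subM.
have t132 : e 1 3 *m e 3 2 = e 1 2 by rewrite !mx3E; congr mx3; ring.
have t123 : e 1 2 *m e 2 3 = e 1 3 by rewrite !mx3E; congr mx3; ring.
have t213 : e 2 1 *m e 1 3 = e 2 3 by rewrite !mx3E; congr mx3; ring.
have t231 : e 2 3 *m e 3 1 = e 2 1 by rewrite !mx3E; congr mx3; ring.
have t312 : e 3 1 *m e 1 2 = e 3 2 by rewrite !mx3E; congr mx3; ring.
have t321 : e 3 2 *m e 2 1 = e 3 1 by rewrite !mx3E; congr mx3; ring.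
have t313 : e 3 1 *m e 1 3 = e 3 3 by rewrite !mx3E; congr mx3; ring.
have t323 : e 3 2 *m e 2 3 = e 3 3 by rewrite !mx3E; congr mx3; ring.
move: (dim_count_units subM M11 M22); rewrite dM /= M11 M22 M33.
move: (trans _ _ _ t132) (trans _ _ _ t123) (trans _ _ _ t213) (trans _ _ _ t231)
      (trans _ _ _ t312) (trans _ _ _ t321) (trans _ _ _ t313) (trans _ _ _ t323).
rewrite M33.
case: (e 1 2 \in M) (e 1 3 \in M) (e 2 1 \in M) (e 2 3 \in M) (e 3 1 \in M)
  (e 3 2 \in M) => [] [] [] [] [] [] => h1 h2 h3 h4 h5 h6 h7 h8 //= _;
  first [ by have := h1 isT isT | by have := h2 isT isT
        | by have := h3 isT isT | by have := h4 isT isT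
        | by have := h5 isT isT | by have := h6 isT isT
        | by have := h7 isT isT | by have := h8 isT isT
        | by constructor 1 | by constructor 2 | by constructor 3
        | by constructor 4; constructor 1 | by constructor 4; constructor 2
        | by constructor 4; constructor 3 ].
Qed.

Definition equivalent M N :=
  exists f, (automorphism f \/ antiautomorphism f) /\ (f @: M)%VS = N.

Lemma dim_M1 : \dim M1 = 5%N.
Proof. by have [_ []] := decompositionsB_valid F 0. Qed.
Lemma dim_M2 : \dim M2 = 5%N.
Proof. by have [_ []] := decompositionsB_valid F ord_max. Qed.

(** Conjugation by a permutation matrix relabels the units.  The next lemma
    adds the transpose, which reverses the order. *)
Lemma equivalent_conj_by M (L : seq 'M[F]_3) g h :
  g *m h = 1%:M -> \dim M = \dim <<L>> -> all (fun X => h *m X *m g \in M) L ->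
  equivalent M <<L>>%VS.
Proof.
move=> gh dM LM; exists (conj_by g h); split; first by left; apply: conj_by_auto.
apply: eq_span_dim; first by rewrite dim_conj_by.
by move=> X /(allP LM) /=; rewrite mem_conj_by.
Qed.

Lemma equivalent_conj_transpose M (L : seq 'M[F]_3) g h :
  g *m h = 1%:M -> \dim M = \dim <<L>> -> all (fun X => (h *m X *m g)^T \in M) L ->
  equivalent M <<L>>%VS.
Proof.
move=> gh dM LM; exists (conj_by g h \o transpose F)%VF.
split.
  by apply: auto_or_anti_comp; [left; apply: conj_by_auto
                             | right; apply: transpose_anti].
rewrite limg_comp.
have inj : injective (transpose F).
  by have [/bij_inj] := transpose_anti F.
apply: eq_span_dim.
  rewrite dim_conj_by // limg_dim_eq //; apply/eqP; rewrite -subv0.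
  by have /lker0P/eqP -> := inj; rewrite capvSr.
move=> X /(allP LM) /=; rewrite mem_conj_by // => MX.
by rewrite -[h *m X *m g]trmxK -transposeE memv_img.
Qed.

(** The index 3, whose diagonal unit is missing, is the last, the middle or the
    first element of the order; M1 and M2 are the first two cases, and the
    transpose exchanges the first and the last place. *)
Lemma normal_form_of_units M : subalgebra M -> \dim M = 5%N -> 1%:M \notin M ->
  e 1 1 \in M -> e 2 2 \in M -> equivalent M M1 \/ equivalent M M2.
Proof.
move=> subM dM nM M11 M22.
have simp := (mulr0, mul0r, mulr1, mul1r, addr0, add0r).
have [] := linear_order_units subM dM nM M11 M22.
- case=> M12 M13 M23; left.
  apply: (@equivalent_conj_by _ _ (mx3 1 0 0 0 1 0 0 0 1)
                                (mx3 1 0 0 0 1 0 0 0 1)).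
  + by rewrite !mx3E !simp.
  + by rewrite dM -dim_M1.
  + by rewrite /= !mx3E !simp -!mx3_e M11 M22 M12 M13 M23.
- case=> M21 M13 M23; left.
  apply: (@equivalent_conj_by _ _ (mx3 0 1 0 1 0 0 0 0 1)
                                (mx3 0 1 0 1 0 0 0 0 1)).
  + by rewrite !mx3E !simp.
  + by rewrite dM -dim_M1.
  + by rewrite /= !mx3E !simp -!mx3_e M11 M22 M21 M13 M23.
- case=> M12 M13 M32; right.
  apply: (@equivalent_conj_by _ _ (mx3 1 0 0 0 0 1 0 1 0)
                                (mx3 1 0 0 0 0 1 0 1 0)).
  + by rewrite !mx3E !simp.
  + by rewrite dM -dim_M2.
  + by rewrite /= !mx3E !simp -!mx3_e M11 M22 M12 M13 M32.
case.
- case=> M21 M31 M23; right.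
  apply: (@equivalent_conj_by _ _ (mx3 0 1 0 0 0 1 1 0 0)
                                (mx3 0 0 1 1 0 0 0 1 0)).
  + by rewrite !mx3E !simp.
  + by rewrite dM -dim_M2.
  + by rewrite /= !mx3E !simp -!mx3_e M11 M22 M21 M31 M23.
- case=> M12 M31 M32; left.
  apply: (@equivalent_conj_transpose _ _ (mx3 0 1 0 1 0 0 0 0 1)
                                (mx3 0 1 0 1 0 0 0 0 1)).
  + by rewrite !mx3E !simp.
  + by rewrite dM -dim_M1.
  + by rewrite /= !mx3E !simp -!mx3_e M11 M22 M12 M31 M32.
- case=> M21 M31 M32; left.
  apply: (@equivalent_conj_transpose _ _ (mx3 1 0 0 0 1 0 0 0 1)
                                (mx3 1 0 0 0 1 0 0 0 1)).
  + by rewrite !mx3E !simp.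
  + by rewrite dM -dim_M1.
  + by rewrite /= !mx3E !simp -!mx3_e M11 M22 M21 M31 M32.
Qed.

Lemma equivalent_of_conj M N g h : g *m h = 1%:M ->
  equivalent (conj_by g h @: M)%VS N -> equivalent M N.
Proof.
move=> gh [f [ff fN]]; exists (f \o conj_by g h)%VF; split.
  by apply: auto_or_anti_comp => //; left; apply: conj_by_auto.
by rewrite limg_comp.
Qed.

Lemma subalgebra_conj M g h : g *m h = 1%:M -> subalgebra M ->
  subalgebra (conj_by g h @: M)%VS.
Proof.
move=> gh subM _ _ /memv_imgP[X MX ->] /memv_imgP[Y MY ->].
by have [_ _ <-] := conj_by_auto gh; rewrite memv_img // subM.
Qed.

Lemma normal_form_dim5 M : 2%:R != 0 :> F ->
  subalgebra M -> \dim M = 5%N -> 1%:M \notin M ->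
  equivalent M M1 \/ equivalent M M2.
Proof.
move=> n2 subM dM nM.
have conj_hyps g h (N : {vspace 'M[F]_3}) : g *m h = 1%:M ->
    subalgebra N -> \dim N = 5%N -> 1%:M \notin N ->
    [/\ subalgebra (conj_by g h @: N)%VS, \dim (conj_by g h @: N) = 5%N
      & 1%:M \notin (conj_by g h @: N)%VS].
  move=> gh subN dN nN; split; first exact: subalgebra_conj.
    by rewrite dim_conj_by.
  by rewrite mem_conj_by // mulmx1 (mulmx1C gh).
have [X MX qX] := exists_trace_defect_neq0 n2 dM nM.
have [g [h [gh ME]]] := exists_rank2_idempotent n2 subM nM MX qX.
have [subM' dM' nM'] := conj_hyps _ _ _ gh subM dM nM.
have [g' [h' [gh' M11 M22]]] := exists_conj_diagonal_units subM' dM' nM' ME.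
have [subM2 dM2 nM2] := conj_hyps _ _ _ gh' subM' dM' nM'.
by have [] := normal_form_of_units subM2 dM2 nM2 M11 M22;
  move=> /(equivalent_of_conj gh')/(equivalent_of_conj gh); [left | right].
Qed.
End Units.

(** * Complements of M1 and M2 *)

Section Complements.
Context (F : fieldType).
Implicit Types (X Y : 'M[F]_3).
Implicit Type M S N : {vspace 'M[F]_3}.
Local Notation e := (e F).
Local Notation M1 := (M1 F).
Local Notation M2 := (M2 F).

Definition upper a b c l f k : 'M[F]_3 := mx3 a b c 0 l f 0 0 k.

Lemma conj_upper_M1 a b c l f k a' b' c' l' f' k' :
  upper a b c l f k *m upper a' b' c' l' f' k' = 1%:M ->
  (conj_by (upper a b c l f k) (upper a' b' c' l' f' k') @: M1)%VS = M1.
Proof.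
move=> gh; apply: eq_span_dim; first by rewrite dim_conj_by.
move=> X; rewrite mem_conj_by // /upper !inE.
by case/or4P=> [||| /orP[]] /eqP->; rewrite !(mx3_mul, mx3_e) mem_M1; solve_eqs.
Qed.

Lemma conj_upper_M2 a b c l f k a' b' c' l' f' k' :
  upper a b c l f k *m upper a' b' c' l' f' k' = 1%:M ->
  (conj_by (upper a b c l f k) (upper a' b' c' l' f' k') @: M2)%VS = M2.
Proof.
move=> gh; apply: eq_span_dim; first by rewrite dim_conj_by.
move=> X; rewrite mem_conj_by // /upper !inE.
by case/or4P=> [||| /orP[]] /eqP->; rewrite !(mx3_mul, mx3_e) mem_M2; solve_eqs.
Qed.

Lemma classified_by_conj i S N (L : seq 'M[F]_3) g h :
  g *m h = 1%:M -> tnth (decompositionsB F) i = (<<L>>%VS, N) ->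
  (conj_by g h @: N)%VS = N -> \dim S = 4%N ->
  all (fun X => h *m X *m g \in S) L -> classified (S, N).
Proof.
move=> gh Bi conjN dS /allP LS.
have [_ [dL _ _ _]] := decompositionsB_valid F i.
apply: (classified_intro (f := conj_by g h) (i := i)).
  by left; apply: conj_by_auto.
rewrite Bi /act /= conjN; congr (_, _); apply: eq_span_dim.
  by rewrite dim_conj_by // dS -dL Bi.
by move=> X LX; rewrite mem_conj_by ?LS.
Qed.

Lemma upper_unipotentK x y z :
  upper 1 x y 1 z 1 *m upper 1 (- x) (x * z - y) 1 (- z) 1 = 1%:M.
Proof. by rewrite /upper !mx3E; congr mx3; ring. Qed.

(** With d the diagonal part of t, the matrix g = t d + (1 - t) (1 - d)
    satisfies t g = t d = g d, and it is unipotent as d^2 + (1 - d)^2 = 1. *)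
Lemma upper_idempotent_conj_diag a b c l f k (t := upper a b c l f k) :
  t *m t = t -> [/\ a * a = a, l * l = l & k * k = k] /\
  exists x y z, upper 1 x y 1 z 1 *m upper a 0 0 l 0 k *m
                upper 1 (- x) (x * z - y) 1 (- z) 1 = t.
Proof.
move=> tt; have [aa ll kk] : [/\ a * a = a, l * l = l & k * k = k].
  move: tt; rewrite /t /upper mx3_mul => /mx3_inj[].
  by rewrite !(mulr0, mul0r, addr0, add0r) => -> _ _ _ -> _ _ _ ->.
split=> //; set d := upper a 0 0 l 0 k; pose g := t *m d + (1%:M - t) *m (1%:M - d).
have dd : d *m d = d.
  by rewrite /d /upper mx3_mul; congr mx3; rewrite ?aa ?ll ?kk; ring.
have idem x : x * x = x -> x * x + (1 - x) * (1 - x) = 1 :> F.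
  by move=> xx; rewrite mulrBl mul1r mulrBr mulr1 xx subrr subr0 addrC subrK.
have gE : g = upper 1 (b * (l + l - 1)) (c * (k + k - 1)) 1 (f * (k + k - 1)) 1.
  rewrite /g /t /d /upper !mx3E; congr mx3; try ring.
  - by rewrite -[RHS](idem _ aa); ring.
  - by rewrite -[RHS](idem _ ll); ring.
  - by rewrite -[RHS](idem _ kk); ring.
have gd : g *m d = t *m g.
  have d0 : (1%:M - d) *m d = 0 by rewrite mulmxBl mul1mx dd subrr.
  have t0 : t *m (1%:M - t) = 0 by rewrite mulmxBr mulmx1 tt subrr.
  rewrite /g [LHS]mulmxDl [RHS]mulmxDr -[in LHS]mulmxA dd -[in LHS]mulmxA d0.
  by rewrite [in RHS]mulmxA tt [in RHS]mulmxA t0 mulmx0 mul0mx.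
exists (b * (l + l - 1)), (c * (k + k - 1)), (f * (k + k - 1)).
rewrite -gE gd gE -mulmxA upper_unipotentK.
exact: mulmx1.
Qed.

(** The consequences of a valid decomposition that the analysis of S uses, in
    terms of elements. *)
Record complement S N : Prop := Complement {
  compl_mul : subalgebra S;
  compl_dim : \dim S = 4%N;
  compl_cap : forall X, X \in S -> X \in N -> X = 0;
  compl_lift : forall X, exists2 Y, Y \in S & X - Y \in N;
  compl_unit : 1%:M \notin S }.

Lemma complement_valid45 S N : valid45 (S, N) -> complement S N.
Proof.
case=> -[subS _ full cap0] [dS _ nS _]; split=> //.
  by move=> X SX NX; apply/eqP; rewrite -memv0 -cap0 memv_cap SX.
move=> X; have : X \in (S + N)%VS by rewrite full memvf.
by case/memv_addP => Y SY [Z NZ ->]; exists Y; rewrite // addrC addKr.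
Qed.


(** M1 consists of upper triangular matrices, so elements of S can be found
    with any prescribed strictly lower part and last entry 0. *)
Lemma lift_lower_M1 S d g h : complement S M1 ->
  exists a b c l f, mx3 a b c d l f g h 0 \in S.
Proof.
case=> _ _ _ lift _; have [Y] := lift (mx3 0 0 0 d 0 0 g h 0).
case: (mx3P Y) => a b c d' l f g' h' k SY.
rewrite !(mx3_add, mx3_opp) mem_M1 => /and4P[/eqP d0 /eqP g0 /eqP h0 /eqP k0].
rewrite -(subr0_eq d0) -(subr0_eq g0) -(subr0_eq h0) -(subr0_eq k0) in SY.
by exists a, b, c, l, f.
Qed.

Lemma lift_lower_M2 S d g h : complement S M2 ->
  exists a b c f k, mx3 a b c d 0 f g h k \in S.
Proof.
case=> _ _ _ lift _; have [Y] := lift (mx3 0 0 0 d 0 0 g h 0).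
case: (mx3P Y) => a b c d' l f g' h' k SY.
rewrite !(mx3_add, mx3_opp) mem_M2 => /and4P[/eqP d0 /eqP l0 /eqP g0 /eqP h0].
rewrite -(subr0_eq d0) -(subr0_eq g0) -(subr0_eq h0) -(subr0_eq l0) in SY.
by exists a, b, c, f, k.
Qed.

(** For t = e22 + e33, sandwiching lifts between t and 1 - t yields e21 and e31
    exactly, and some w = e32 + m e22 + v e23 - m e33, made traceless by
    subtracting a multiple of t.  A conjugation by 1 - m e23 changes w into
    e32 + (v + m^2) e23, whose coefficient is zero or can be scaled to 1 by means
    of its square root.  The spaces M1 and M2 behave alike here. *)
Lemma classified_diag_0_1_1 S N (i j : 'I_9) :
  (forall x : F, exists y, y * y = x) -> 2%:R != 0 :> F ->
  complement S N ->
  tnth (decompositionsB F) i =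
    (<<[:: e 2 1; e 3 1; e 3 2; e 2 2 + e 3 3]%R>>%VS, N) ->
  tnth (decompositionsB F) j =
    (<<[:: e 2 1; e 3 1; e 3 2 + e 2 3; e 2 2 + e 3 3]%R>>%VS, N) ->
  N = M1 \/ N = M2 ->
  upper 0 0 0 1 0 1 \in S -> classified (S, N).
Proof.
move=> sqrtF n2 complS Bi Bj N12; have [subS dS _ _ _] := complS.
set t := upper _ _ _ _ _ _ => St.
have Sl X : X \in S -> t *m X \in S by exact: subS.
have Sr X : X \in S -> X *m t \in S by move=> SX; exact: subS.
have lower d g h : exists a b c l f k, mx3 a b c d l f g h k \in S.
  case: N12 complS => -> complS.
    have [a [b [c [l [f SX]]]]] := lift_lower_M1 d g h complS.
    by exists a, b, c, l, f, 0.
  have [a [b [c [f [k SX]]]]] := lift_lower_M2 d g h complS.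
  by exists a, b, c, 0, f, k.
have S21 : e 2 1 \in S.
  have [a [b [c [l [f [k SX]]]]]] := lower 1 0 0.
  rewrite (_ : e 2 1 = t *m mx3 a b c 1 l f 0 0 k - t *m mx3 a b c 1 l f 0 0 k *m t).
    by rewrite memvB ?Sr ?Sl.
  by rewrite /t /upper !mx3E; congr mx3; ring.
have S31 : e 3 1 \in S.
  have [a [b [c [l [f [k SX]]]]]] := lower 0 1 0.
  rewrite (_ : e 3 1 = t *m mx3 a b c 0 l f 1 0 k - t *m mx3 a b c 0 l f 1 0 k *m t).
    by rewrite memvB ?Sr ?Sl.
  by rewrite /t /upper !mx3E; congr mx3; ring.
have [m [v Sw]] : exists m v, mx3 0 0 0 0 m v 0 1 (- m) \in S.
  have [a [b [c [l [f [k SX]]]]]] := lower 0 0 1.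
  exists ((l - k) / 2%:R), f.
  rewrite (_ : mx3 _ _ _ _ _ _ _ _ _ = t *m mx3 a b c 0 l f 0 1 k *m t
             - ((l + k) / 2%:R) *: t).
    by rewrite memvB ?memvZ ?Sr ?Sl.
  by rewrite /t /upper !mx3E; congr mx3; try ring; field.
have conjN x y z p q r x' y' z' p' q' r' :
    upper p x y q z r *m upper p' x' y' q' z' r' = 1%:M ->
    (conj_by (upper p x y q z r) (upper p' x' y' q' z' r') @: N)%VS = N.
  by case: N12 => ->; [exact: conj_upper_M1 | exact: conj_upper_M2].
have [r rr] := sqrtF (v + m * m).
have [r0 | r0] := eqVneq r 0.
  have gh : upper 1 0 0 1 (- m) 1 *m upper 1 0 0 1 m 1 = 1%:M.
    by rewrite /upper !mx3E; congr mx3; ring.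
  apply: (classified_by_conj gh Bi (conjN _ _ _ _ _ _ _ _ _ _ _ _ gh) dS).
  have vE : v = - (m * m) by apply/eqP; rewrite -addr_eq0 -rr r0 mulr0.
  rewrite /= andbT; apply/and4P; split.
  - by rewrite (_ : _ *m _ *m _ = e 2 1) // /upper !mx3E; congr mx3; ring.
  - rewrite (_ : _ *m _ *m _ = e 3 1 + m *: e 2 1) ?memvD ?memvZ //.
    by rewrite /upper !mx3E; congr mx3; ring.
  - rewrite (_ : _ *m _ *m _ = mx3 0 0 0 0 m v 0 1 (- m)) // vE.
    by rewrite /upper !mx3E; congr mx3; ring.
  - rewrite (_ : _ *m _ *m _ = t) //.
    by rewrite /t /upper !mx3E; congr mx3; ring.
have gh : upper 1 0 0 1 (- m) r *m upper 1 0 0 1 (m / r) r^-1 = 1%:M.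
  by rewrite /upper !mx3E; congr mx3; try ring; field.
apply: (classified_by_conj gh Bj (conjN _ _ _ _ _ _ _ _ _ _ _ _ gh) dS).
have vE : v = r * r - (m * m) by rewrite rr addrK.
rewrite /= andbT; apply/and4P; split.
- by rewrite (_ : _ *m _ *m _ = e 2 1) // /upper !mx3E; congr mx3; ring.
- rewrite (_ : _ *m _ *m _ = r^-1 *: (e 3 1 + m *: e 2 1)) ?memvZ ?memvD ?memvZ //.
  by rewrite /upper !mx3E; congr mx3; try ring; field.
- rewrite (_ : _ *m _ *m _ = r^-1 *: mx3 0 0 0 0 m v 0 1 (- m)) ?memvZ // vE.
  by rewrite /upper !mx3E; congr mx3; try ring; field.
- rewrite (_ : _ *m _ *m _ = t) //.
  by rewrite /t /upper !mx3E; congr mx3; try ring; field.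
Qed.

Ltac mxfield := rewrite /upper !mx3E; congr mx3; try ring; field.

(** For t = e33, S contains e31, e32 and some z = e21 + p e11 + w e12 + u e22.
    By Cayley-Hamilton z^2 - (tr z) z is a multiple of e11 + e22, which lies
    in M1; so it is zero and w = p u.  Thus z is conjugate to
    e21 + (p + u) e11, and p + u = 0 separates the two possible outcomes. *)
Lemma classified_M1_diag_0_0_1 S : complement S M1 -> upper 0 0 0 0 0 1 \in S ->
  classified (S, M1).
Proof.
move=> complS; have [subS dS cap _ _] := complS.
set t := upper _ _ _ _ _ _ => St.
have Sl X : X \in S -> t *m X \in S by exact: subS.
have Sr X : X \in S -> X *m t \in S by move=> SX; exact: subS.
have S31 : e 3 1 \in S.
  have [a [b [c [l [f SX]]]]] := lift_lower_M1 0 1 0 complS.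
  rewrite (_ : e 3 1 = t *m mx3 a b c 0 l f 1 0 0) ?Sl //.
  by rewrite /t /upper !mx3E; congr mx3; ring.
have S32 : e 3 2 \in S.
  have [a [b [c [l [f SX]]]]] := lift_lower_M1 0 0 1 complS.
  rewrite (_ : e 3 2 = t *m mx3 a b c 0 l f 0 1 0) ?Sl //.
  by rewrite /t /upper !mx3E; congr mx3; ring.
have [p [w [u Sz]]] : exists p w u, mx3 p w 0 1 u 0 0 0 0 \in S.
  have [a [b [c [l [f]]]]] := lift_lower_M1 1 0 0 complS.
  set X := mx3 _ _ _ _ _ _ _ _ _ => SX; exists a, b, l.
  rewrite (_ : mx3 _ _ _ _ _ _ _ _ _ = X - t *m X - X *m t + t *m X *m t).
    by rewrite memvD ?memvB ?Sr ?Sl // Sr.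
  by rewrite /X /t /upper !mx3E; congr mx3; ring.
have wE : w = p * u.
  have : mx3 (w - p * u) 0 0 0 (w - p * u) 0 0 0 0 = 0.
    apply: cap; last by rewrite mem_M1 !eqxx.
    set z := mx3 p w 0 1 u 0 0 0 0 in Sz.
    rewrite (_ : mx3 _ _ _ _ _ _ _ _ _ = z *m z - (p + u) *: z).
      by rewrite memvB ?memvZ ?subS.
    by rewrite /z !mx3E; congr mx3; ring.
  by rewrite mx3_0 => /mx3_inj[/subr0_eq].
have [tau0 | tau0] := eqVneq (p + u) 0.
  have gh : upper 1 u 0 1 0 1 *m upper 1 (- u) 0 1 0 1 = 1%:M.
    by rewrite /upper !mx3E; congr mx3; ring.
  apply: (classified_by_conj (i := inord 0) gh _ (conj_upper_M1 gh) dS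
         (L := [:: e 2 1; e 3 1; e 3 2; e 3 3])).
    by rewrite (tnth_nth (0, 0)%VS) inordK.
  have pE : p = - u by apply/eqP; rewrite -addr_eq0 tau0.
  rewrite /= andbT; apply/and4P; split.
  - rewrite (_ : _ *m _ *m _ = mx3 p w 0 1 u 0 0 0 0) // wE pE.
    by rewrite /upper !mx3E; congr mx3; ring.
  - rewrite (_ : _ *m _ *m _ = e 3 1 + u *: e 3 2) ?memvD ?memvZ //.
    by rewrite /upper !mx3E; congr mx3; ring.
  - rewrite (_ : _ *m _ *m _ = e 3 2) //.
    by rewrite /upper !mx3E; congr mx3; ring.
  - rewrite (_ : _ *m _ *m _ = t) //.
    by rewrite /t /upper !mx3E; congr mx3; ring.
have gh : upper 1 u 0 (p + u) 0 1 *m upper 1 (- u / (p + u)) 0 (p + u)^-1 0 1 = 1%:M.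
  by mxfield.
apply: (classified_by_conj (i := inord 1) gh _ (conj_upper_M1 gh) dS
         (L := [:: (e 1 1 + e 2 1)%R; e 3 1; e 3 2; e 3 3])).
  by rewrite (tnth_nth (0, 0)%VS) inordK.
rewrite /= andbT; apply/and4P; split.
- rewrite (_ : _ *m _ *m _ = (p + u)^-1 *: mx3 p w 0 1 u 0 0 0 0) ?memvZ // wE.
  by mxfield.
- rewrite (_ : _ *m _ *m _ = e 3 1 + u *: e 3 2) ?memvD ?memvZ //.
  by mxfield.
- rewrite (_ : _ *m _ *m _ = (p + u) *: e 3 2) ?memvZ //.
  by mxfield.
- rewrite (_ : _ *m _ *m _ = t) //.
  by rewrite /t; mxfield.
Qed.

(** For t = e11 + e33, S contains x = e32 + p e12 and y = e21 + v e23.  The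
    product y x is a multiple of e22, which lies in M1, so v = - p, and
    conjugation by 1 - p e13 changes x and y into e32 and e21. *)
Lemma classified_M1_diag_1_0_1 S : complement S M1 -> upper 1 0 0 0 0 1 \in S ->
  classified (S, M1).
Proof.
move=> complS; have [subS dS cap _ _] := complS.
set t := upper _ _ _ _ _ _ => St.
have [p Sx] : exists p, mx3 0 p 0 0 0 0 0 1 0 \in S.
  have [a [b [c [l [f]]]]] := lift_lower_M1 0 0 1 complS.
  set X := mx3 _ _ _ _ _ _ _ _ _ => SX; exists b.
  rewrite (_ : mx3 _ _ _ _ _ _ _ _ _ = t *m X - t *m X *m t).
    by rewrite memvB ?subS // subS.
  by rewrite /X /t /upper !mx3E; congr mx3; ring.
have [v Sy] : exists v, mx3 0 0 0 1 0 v 0 0 0 \in S.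
  have [a [b [c [l [f]]]]] := lift_lower_M1 1 0 0 complS.
  set X := mx3 _ _ _ _ _ _ _ _ _ => SX; exists f.
  rewrite (_ : mx3 _ _ _ _ _ _ _ _ _ = X *m t - t *m X *m t).
    by rewrite memvB ?subS // subS.
  by rewrite /X /t /upper !mx3E; congr mx3; ring.
have vE : v = - p.
  have /mx3_inj : mx3 0 0 0 0 (p + v) 0 0 0 0 = mx3 0 0 0 0 0 0 0 0 0.
    rewrite -mx3_0; apply: cap; last by rewrite mem_M1 !eqxx.
    rewrite (_ : mx3 _ _ _ _ _ _ _ _ _ =
      mx3 0 0 0 1 0 v 0 0 0 *m mx3 0 p 0 0 0 0 0 1 0) ?subS //.
    by rewrite !mx3E; congr mx3; ring.
  by case=> /eqP; rewrite addrC addr_eq0 => /eqP.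
have gh : upper 1 0 (- p) 1 0 1 *m upper 1 0 p 1 0 1 = 1%:M.
  by rewrite /upper !mx3E; congr mx3; ring.
apply: (classified_by_conj (i := inord 4) gh _ (conj_upper_M1 gh) dS
         (L := [:: e 2 1; e 3 1; e 3 2; (e 1 1 + e 3 3)%R])).
  by rewrite (tnth_nth (0, 0)%VS) inordK.
rewrite /= andbT; apply/and4P; split.
- rewrite (_ : _ *m _ *m _ = mx3 0 0 0 1 0 v 0 0 0) // vE.
  by rewrite /upper !mx3E; congr mx3; ring.
- rewrite (_ : _ *m _ *m _ =
    mx3 0 p 0 0 0 0 0 1 0 *m mx3 0 0 0 1 0 v 0 0 0) ?subS // vE.
  by rewrite /upper !mx3E; congr mx3; ring.
- rewrite (_ : _ *m _ *m _ = mx3 0 p 0 0 0 0 0 1 0) //.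
  by rewrite /upper !mx3E; congr mx3; ring.
- rewrite (_ : _ *m _ *m _ = t) //.
  by rewrite /t /upper !mx3E; congr mx3; ring.
Qed.

(** For t = e22, S contains x = e32 + p e12 and y = e21 + v e23.  Now e22 is in
    S, so y x gives no condition: conjugation by 1 + v e13 changes y into e21
    and x into e32 + (p + v) e12, and p + v = 0 separates the two outcomes. *)
Lemma classified_M2_diag_0_1_0 S : complement S M2 -> upper 0 0 0 1 0 0 \in S ->
  classified (S, M2).
Proof.
move=> complS; have [subS dS _ _ _] := complS.
set t := upper _ _ _ _ _ _ => St.
have [p Sx] : exists p, mx3 0 p 0 0 0 0 0 1 0 \in S.
  have [a [b [c [f [k]]]]] := lift_lower_M2 0 0 1 complS.
  set X := mx3 _ _ _ _ _ _ _ _ _ => SX; exists b.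
  rewrite (_ : mx3 _ _ _ _ _ _ _ _ _ = X *m t - t *m X *m t).
    by rewrite memvB ?subS // subS.
  by rewrite /X /t /upper !mx3E; congr mx3; ring.
have [v Sy] : exists v, mx3 0 0 0 1 0 v 0 0 0 \in S.
  have [a [b [c [f [k]]]]] := lift_lower_M2 1 0 0 complS.
  set X := mx3 _ _ _ _ _ _ _ _ _ => SX; exists f.
  rewrite (_ : mx3 _ _ _ _ _ _ _ _ _ = t *m X - t *m X *m t).
    by rewrite memvB ?subS // subS.
  by rewrite /X /t /upper !mx3E; congr mx3; ring.
have Sxy := subS _ _ Sx Sy.
have [gamma0 | gamma0] := eqVneq (p + v) 0.
  have gh : upper 1 0 v 1 0 1 *m upper 1 0 (- v) 1 0 1 = 1%:M.
    by rewrite /upper !mx3E; congr mx3; ring.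
  apply: (classified_by_conj (i := inord 5) gh _ (conj_upper_M2 gh) dS
         (L := [:: e 2 1; e 3 1; e 3 2; e 2 2])).
    by rewrite (tnth_nth (0, 0)%VS) inordK.
  have pE : p = - v by apply/eqP; rewrite -addr_eq0 gamma0.
  rewrite /= andbT; apply/and4P; split.
  - rewrite (_ : _ *m _ *m _ = mx3 0 0 0 1 0 v 0 0 0) //.
    by rewrite /upper !mx3E; congr mx3; ring.
  - rewrite (_ : _ *m _ *m _ =
    mx3 0 p 0 0 0 0 0 1 0 *m mx3 0 0 0 1 0 v 0 0 0) // pE.
    by rewrite /upper !mx3E; congr mx3; ring.
  - rewrite (_ : _ *m _ *m _ = mx3 0 p 0 0 0 0 0 1 0) // pE.
    by rewrite /upper !mx3E; congr mx3; ring.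
  - rewrite (_ : _ *m _ *m _ = t) //.
    by rewrite /t /upper !mx3E; congr mx3; ring.
have gh : upper 1 0 v 1 0 (p + v) *m upper 1 0 (- v / (p + v)) 1 0 (p + v)^-1 = 1%:M.
  by mxfield.
apply: (classified_by_conj (i := inord 6) gh _ (conj_upper_M2 gh) dS
         (L := [:: e 2 1; (e 1 1 + e 3 1)%R; (e 1 2 + e 3 2)%R; e 2 2])).
  by rewrite (tnth_nth (0, 0)%VS) inordK.
rewrite /= andbT; apply/and4P; split.
- rewrite (_ : _ *m _ *m _ = mx3 0 0 0 1 0 v 0 0 0) //.
  by mxfield.
- rewrite (_ : _ *m _ *m _ = (p + v)^-1 *:
    (mx3 0 p 0 0 0 0 0 1 0 *m mx3 0 0 0 1 0 v 0 0 0)) ?memvZ //.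
  by mxfield.
- rewrite (_ : _ *m _ *m _ = (p + v)^-1 *: mx3 0 p 0 0 0 0 0 1 0) ?memvZ //.
  by mxfield.
- rewrite (_ : _ *m _ *m _ = t) //.
  by rewrite /t; mxfield.
Qed.

End Complements.

(** * The classification *)

Section Assembly.
Context (F : fieldType).
Context (sqrtF : forall x : F, exists y, y * y = x).
Context (two_neq0 : 2%:R != 0 :> F).
Implicit Type S : {vspace 'M[F]_3}.
Local Notation M1 := (M1 F).
Local Notation M2 := (M2 F).

Lemma idempotent_scalar (x : F) : x * x = x -> x = 0 \/ x = 1.
Proof.
move/eqP; rewrite -subr_eq0 -{3}[x]mulr1 -mulrBr mulf_eq0 subr_eq0.
by case/orP=> /eqP; [left | right].
Qed.

Lemma classified_up_to_unipotent S N x y z a l k (U := upper 1 x y 1 z 1)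
    (V := upper 1 (- x) (x * z - y) 1 (- z) 1) :
  N = M1 \/ N = M2 -> valid45 (S, N) ->
  U *m upper a 0 0 l 0 k *m V \in S ->
  (forall S', valid45 (S', N) -> upper a 0 0 l 0 k \in S' -> classified (S', N)) ->
  classified (S, N).
Proof.
move=> N12 vS St cl; have UV : U *m V = 1%:M by apply: upper_unipotentK.
have VU := mulmx1C UV.
have auto : automorphism (conj_by V U) \/ antiautomorphism (conj_by V U).
  by left; apply: conj_by_auto.
have conjN : (conj_by V U @: N)%VS = N.
  by case: N12 => ->; [exact: conj_upper_M1 | exact: conj_upper_M2].
apply: (classified_act auto); have := valid45_act auto vS.
by rewrite /act /= conjN => vS'; apply: cl vS' _; rewrite mem_conj_by.
Qed.

Lemma classified_M1 S : valid45 (S, M1) -> classified (S, M1).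
Proof.
move=> vS; have complS := complement_valid45 vS.
have [subS dS cap lift nS] := complS.
have [Y SY] := lift 1%:M; move: SY; case: (mx3P Y) => a b c d l f g h k SY.
rewrite !(mx3_1, mx3_add, mx3_opp) mem_M1 !sub0r !oppr_eq0.
case/and4P=> /eqP d0 /eqP g0 /eqP h0; rewrite subr_eq0 => /eqP/esym k1.
rewrite {}d0 {}g0 {}h0 {}k1 in SY.
(* t^2 - t lies in S and has last entry 0, so it lies in M1 too. *)
have tt : upper a b c l f 1 *m upper a b c l f 1 = upper a b c l f 1.
  apply: subr0_eq; apply: cap; first by rewrite memvB ?subS.
  by rewrite /upper !(mx3_mul, mx3_add, mx3_opp) mem_M1; solve_eqs.
have [[aa ll _] [x [y [z tE]]]] := upper_idempotent_conj_diag tt.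
apply: (@classified_up_to_unipotent S M1 x y z a l 1) => //; first by left.
  by rewrite tE.
move=> S' vS'; have complS' := complement_valid45 vS'.
case: (idempotent_scalar aa) => ->; case: (idempotent_scalar ll) => ->.
- exact: classified_M1_diag_0_0_1.
- apply: (@classified_diag_0_1_1 _ S' M1 (inord 2) (inord 3)) => //;
    try by rewrite (tnth_nth (0, 0)%VS) inordK.
  by left.
- exact: classified_M1_diag_1_0_1.
- (* the diagonal part of t is the identity, which is not in S *)
  by rewrite /upper -mx3_1 => S1; case/negP: (compl_unit complS').
Qed.

(** The three diagonal idempotents are e22, e22 + e33 and e11 + e22.  The last
    one is sent to the second by the reflection in the antidiagonal, an
    antiautomorphism that preserves M2. *)
Lemma classified_M2 S : valid45 (S, M2) -> classified (S, M2).
Proof.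
move=> vS; have complS := complement_valid45 vS.
have [subS dS cap lift nS] := complS.
have [Y SY] := lift 1%:M; move: SY; case: (mx3P Y) => a b c d l f g h k SY.
rewrite !(mx3_1, mx3_add, mx3_opp) mem_M2 !sub0r !oppr_eq0.
case/and4P=> /eqP d0; rewrite subr_eq0 => /eqP/esym l1 /eqP g0 /eqP h0.
rewrite {}d0 {}g0 {}h0 {}l1 in SY.
have tt : upper a b c 1 f k *m upper a b c 1 f k = upper a b c 1 f k.
  apply: subr0_eq; apply: cap; first by rewrite memvB ?subS.
  by rewrite /upper !(mx3_mul, mx3_add, mx3_opp) mem_M2; solve_eqs.
have [[aa _ kk] [x [y [z tE]]]] := upper_idempotent_conj_diag tt.
apply: (@classified_up_to_unipotent S M2 x y z a 1 k) => //; first by right.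
  by rewrite tE.
have cl011 S' : valid45 (S', M2) -> upper 0 0 0 1 0 1 \in S' -> classified (S', M2).
  move/complement_valid45=> complS'.
  apply: (@classified_diag_0_1_1 _ S' M2 (inord 7) (inord 8)) => //;
    try by rewrite (tnth_nth (0, 0)%VS) inordK.
  by right.
move=> S' vS'; have complS' := complement_valid45 vS'.
case: (idempotent_scalar aa) => ->; case: (idempotent_scalar kk) => ->.
- exact: classified_M2_diag_0_1_0.
- exact: cl011.
- move=> S'110; pose J : 'M[F]_3 := mx3 0 0 1 0 1 0 1 0 0.
  have JJ : J *m J = 1%:M by rewrite /J !mx3E; congr mx3; ring.
  pose r := (conj_by J J \o transpose F)%VF.
  have rE X : r X = J *m X^T *m J by rewrite comp_lfunE conj_byE transposeE.
  have aa_r : automorphism r \/ antiautomorphism r.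
    by apply: auto_or_anti_comp; [left; apply: conj_by_auto
                               | right; apply: transpose_anti].
  apply: (classified_act aa_r); have := valid45_act aa_r vS'.
  have -> : act r (S', M2) = ((r @: S')%VS, M2).
    congr (_, _); apply: eq_span_dim.
      by have [_ [_ -> _ _]] := valid45_act aa_r vS'; rewrite -(dim_M2 F).
    have in_r X : J *m X^T *m J \in M2 -> X \in (r @: M2)%VS.
      move=> MX; rewrite (_ : X = r (J *m X^T *m J)) ?memv_img // rE.
      move: X {MX} => X; case: (mx3P X) => *; rewrite /J !mx3E; congr mx3; ring.
    move=> X; rewrite !inE => XL; apply: in_r; move: XL.
    by case/or4P=> [||| /orP[]] /eqP->; rewrite /J !(mx3_e, mx3_tr, mx3_mul) mem_M2;
      solve_eqs.
  move=> vr; apply: cl011 => //.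
  rewrite (_ : upper _ _ _ _ _ _ = r (upper 1 0 0 1 0 0)) ?memv_img // rE.
  by rewrite /upper /J !mx3E; congr mx3; ring.
- (* the diagonal part of t is the identity, which is not in S *)
  by rewrite /upper -mx3_1 => S1; case/negP: (compl_unit complS').
Qed.

Lemma decompositions_classified S (M : {vspace 'M[F]_3}) :
  direct_decomposition (S, M) -> nonunital_4_5 (S, M) -> classified (S, M).
Proof.
move=> dir nonunital; have vSM : valid45 (S, M) by [].
have [[_ subM _ _] [_ dM _ nM]] := vSM.
have [] := normal_form_dim5 two_neq0 subM dM nM => -[f [ff fM]];
  apply: (classified_act ff); have := valid45_act ff vSM;
  rewrite /act /= fM; [exact: classified_M1 | exact: classified_M2].
Qed.

End Assembly.

Theorem theorem2 (R : realType) :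
  [/\ (* (B1)-(B9) are decompositions of the kind being classified *)
      forall i : 'I_9,
        direct_decomposition (tnth (decompositionsB R[i]) i) /\
        nonunital_4_5 (tnth (decompositionsB R[i]) i),
      (* classification *)
      forall S M : {vspace 'M[R[i]]_3},
        direct_decomposition (S, M) -> nonunital_4_5 (S, M) ->
        exists (i : 'I_9) (phi : 'End('M[R[i]]_3)),
          automorphism phi /\
          (act phi (S, M) = tnth (decompositionsB R[i]) i \/
           act (transpose R[i] \o phi)%VF (S, M)
             = tnth (decompositionsB R[i]) i)
    & (* pairwise different orbits *)
      forall i j : 'I_9, i != j ->
        ~ exists f : 'End('M[R[i]]_3),
            (automorphism f \/ antiautomorphism f) /\
            act f (tnth (decompositionsB R[i]) i)
              = tnth (decompositionsB R[i]) j].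
Proof.
have n2 : 2%:R != 0 :> R[i] by rewrite Num.Theory.pnatr_eq0.
have n3 : 3%:R != 0 :> R[i] by rewrite Num.Theory.pnatr_eq0.
split.
- exact: decompositionsB_valid.
- apply: decompositions_classified => // x.
  by exists (Num.Theory.sqrtC x); rewrite -expr2 Num.Theory.sqrtCK.
- by move=> i j; apply: decompositionsB_inequivalent.
Qed.
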